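(* Let $H$ be a monoid. The following are equivalent: (1) $H$ is a $t$-almost Dedekind $t$-SP-monoid (i.e. both $t$-almost Dedekind and a $t$-SP-monoid). (2) $H$ is a $t$-finite conductor monoid and every principal ideal of $H$ is a finite $t$-product of radical $t$-ideals of $H$. (3) Every $t$-ideal of $H$ is a $t$-product of finitely many pairwise comparable radical $t$-ideals of $H$. (4) The radical of every nontrivial principal ideal of $H$ is $t$-invertible.
   Context: A monoid $H$ is a commutative semigroup with identity and more than one element in which every nonzero element is cancellative. Here $z(H)=\{z\in H: zx=z \text{ for all } x\in H\}$ ($|z(H)|\le 1$, possibly empty); ''nonzero'' means not in $z(H)$; $H^{\bullet}=H\setminus z(H)$; $G=(H^{\bullet})^{-1}H$ is the quotient monoid; $\mathbb{N}$ is the set of positive integers. For $X\subseteq H$, $\sqrt X=\{x\in H: x^n\in X\text{ for some }n\in\mathbb{N}\}$; for $Y\subseteq G$, $Y^{-1}=\{z\in G: zY\subseteq H\}$. $X\subseteq H$ is an $s$-ideal if $X=XH\cup z(H)$; it is radical if $\sqrt X=X$; nontrivial if $z(H)\subsetneq X$; proper if $X\ne H$. A principal ideal is a set $AH\cup z(H)$ with $A\subseteq H$, $|A|\le 1$. A prime $s$-ideal is a proper $s$-ideal $P$ such that $xy\in P$ implies $x\in P$ or $y\in P$; $H_P=(H\setminus P)^{-1}H$. The $t$-system on $H$: if $H=G$, then for $X\subseteq H$ put $X_t=z(H)$ if $X\subseteq z(H)$ and $X_t=H$ otherwise; if $H\neq G$, put $X_v=(X^{-1})^{-1}$ and $X_t=\bigcup_{E\subseteq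 X,|E|<\infty}E_v$. A $t$-ideal is an $X\subseteq H$ with $X_t=X$; it is $t$-invertible if $(XX^{-1})_t=H$; a $t$-ideal $I$ is $t$-finitely generated if $I=E_t$ for some finite $E\subseteq I$. The $t$-product of $t$-ideals $I,J$ is $(IJ)_t$ (similarly for finitely many factors). $t$-$\max(H)$ is the set of maximal elements among the proper $t$-ideals. If $H\neq G$, $H$ is a DVM (discrete valuation monoid) if every $s$-ideal of $H$ is principal. $H$ is $t$-almost Dedekind if $H=G$ or $H_M$ is a DVM for each $M\in t$-$\max(H)$. $H$ is a $t$-SP-monoid if every $t$-ideal of $H$ is a finite $t$-product of radical $t$-ideals. $H$ is a $t$-finite conductor monoid if $xH\cap yH$ is $t$-finitely generated for all $x,y\in H$. ''Comparable'' means comparable with respect to inclusion. *)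

(* Defs.v *)
From HB Require Import structures.
From mathcomp Require Import all_boot.
From mathcomp Require Import all_classical.

Set Implicit Arguments.
Unset Strict Implicit.
Unset Printing Implicit Defensive.

Local Open Scope group_scope.
Local Open Scope classical_set_scope.
Local Open Scope quotient_scope.

Definition zset (T : magmaType) : set T := [set z | forall x, z * x = z].
Arguments zset T : clear implicits.

HB.mixin Record isCancelMonoid T of Monoid T := {
  mulgC : commutative (fun x y : T => x * y);
  cancel_nontrivial : exists x y : T, x <> y;
  nonzero_mulgI : forall x : T, ~ zset T x -> injective (fun y => x * y)
}.

#[short(type="cancelMonoidType")]
HB.structure Definition CancelMonoid := {T of isCancelMonoid T & Monoid T}.

Arguments nonzero_mulgI {s} x _ [x1 x2] : rename.

Section CancelMonoidTheory.
Variable H : cancelMonoidType.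
Implicit Types x y z : H.

Lemma nonzero1 : ~ zset H 1.
Proof.
move=> z1; have [x [y]] := @cancel_nontrivial H; apply.
by rewrite -(mul1g x) -(mul1g y) !z1.
Qed.

Lemma nonzeroM x y : ~ zset H x -> ~ zset H y -> ~ zset H (x * y).
Proof.
move=> nx ny zxy; apply: nx => t; apply: (nonzero_mulgI _ ny) => /=.
by rewrite (mulgC y (x * t)) (mulgC y x) -mulgA (mulgC t) mulgA zxy.
Qed.

End CancelMonoidTheory.

Record denom (H : cancelMonoidType) := Denom {
  denom_set :> set H;
  denom1 : denom_set 1;
  denomM : forall x y, denom_set x -> denom_set y -> denom_set (x * y);
  denom_nz : forall x, denom_set x -> ~ zset H x
}.

(* The localization S^-1 H: pairs (h, s) with s in S, where (h, s) and (k, u) *)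
(* are identified when h u = k s.                                             *)
Section Localization.
Variables (H : cancelMonoidType) (S : denom H).

Definition frac : Type := (H * set_type S)%type.
HB.instance Definition _ := Choice.on frac.

Definition frac_eq (a b : frac) : bool := a.1 * val b.2 == b.1 * val a.2.

Lemma frac_nz (a : frac) : ~ zset H (val a.2).
Proof. by apply: (@denom_nz _ S); exact: set_valP. Qed.

Lemma frac_eq_refl : reflexive frac_eq.
Proof. by move=> a; rewrite /frac_eq. Qed.

Lemma frac_eq_sym : symmetric frac_eq.
Proof. by move=> a b; rewrite /frac_eq eq_sym. Qed.

Lemma frac_eq_trans : transitive frac_eq.
Proof.
move=> b a c /eqP ab /eqP bc; apply/eqP/(nonzero_mulgI _ (frac_nz (a := b))).
rewrite mulgA (mulgC _ a.1) ab -mulgA (mulgC (val a.2)) mulgA bc.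
by rewrite (mulgC _ (val b.2)) -mulgA.
Qed.

Canonical frac_equiv := EquivRel frac_eq frac_eq_refl frac_eq_sym frac_eq_trans.

Definition loc : Type := {eq_quot frac_equiv}.
HB.instance Definition _ := EqQuotient.on loc.
HB.instance Definition _ := Choice.on loc.

Definition mkfrac (h : H) (s : set_type S) : loc := \pi_loc (h, s).

Lemma eq_mkfrac h s k u : mkfrac h s = mkfrac k u <-> h * val u = k * val s.
Proof.
split; first by move=> /eqmodP /eqP.
by move=> e; apply/eqmodP/eqP.
Qed.

Lemma mkfrac_repr (x : loc) : x = mkfrac (repr x).1 (repr x).2.
Proof. by rewrite /mkfrac -surjective_pairing reprK. Qed.

Definition den1 : set_type S := SigSub (mem_set (denom1 S)).

Definition denmul (s u : set_type S) : set_type S :=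
  SigSub (mem_set (@denomM _ S _ _ (set_valP s) (set_valP u))).

Definition loc1 : loc := mkfrac 1 den1.

Definition locmul (x y : loc) : loc :=
  mkfrac ((repr x).1 * (repr y).1) (denmul (repr x).2 (repr y).2).

Lemma mulgACA4 (a b c d : H) : a * b * (c * d) = a * c * (b * d).
Proof. by rewrite -mulgA (mulgA b) (mulgC b) -!mulgA. Qed.

Lemma locmulE h s k u :
  locmul (mkfrac h s) (mkfrac k u) = mkfrac (h * k) (denmul s u).
Proof.
rewrite /locmul; apply/eq_mkfrac => /=.
have /eq_mkfrac e1 := esym (mkfrac_repr (mkfrac h s)).
have /eq_mkfrac e2 := esym (mkfrac_repr (mkfrac k u)).
by rewrite mulgACA4 e1 e2 mulgACA4.
Qed.

Lemma locmulA : associative locmul.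
Proof.
move=> x y z; rewrite (mkfrac_repr x) (mkfrac_repr y) (mkfrac_repr z) !locmulE.
by apply/eq_mkfrac; rewrite /= !mulgA.
Qed.

Lemma locmul1g : left_id loc1 locmul.
Proof.
move=> x; rewrite (mkfrac_repr x) locmulE.
by apply/eq_mkfrac; rewrite /= !mul1g.
Qed.

Lemma locmulg1 : right_id loc1 locmul.
Proof.
move=> x; rewrite (mkfrac_repr x) locmulE.
by apply/eq_mkfrac; rewrite /= !mulg1.
Qed.

HB.instance Definition _ := isMonoid.Build loc locmulA locmul1g locmulg1.

Lemma mkfracM h s k u :
  mkfrac h s * mkfrac k u = mkfrac (h * k) (denmul s u).
Proof. exact: locmulE. Qed.

Definition toloc (h : H) : loc := mkfrac h den1.

Lemma toloc_inj : injective toloc.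
Proof. by move=> h k /eq_mkfrac; rewrite /= !mulg1. Qed.

Lemma toloc_monoid_morphism : monoid_morphism toloc.
Proof.
split=> // h k; rewrite mkfracM.
by apply/eq_mkfrac; rewrite /= !mulg1.
Qed.

HB.instance Definition _ :=
  isUMagmaMorphism.Build H loc toloc toloc_monoid_morphism.

Lemma locmulC : commutative (fun x y : loc => x * y).
Proof.
move=> x y; rewrite (mkfrac_repr x) (mkfrac_repr y) !mkfracM.
by apply/eq_mkfrac; rewrite /= (mulgC (repr x).1) (mulgC (val (repr x).2)).
Qed.

Lemma loc_nontrivial : exists x y : loc, x <> y.
Proof.
have [x [y ne]] := @cancel_nontrivial H.
by exists (toloc x), (toloc y) => /toloc_inj.
Qed.

Lemma zset_mkfrac h s : zset H h -> zset loc (mkfrac h s).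
Proof.
move=> zh x; rewrite (mkfrac_repr x) mkfracM.
by apply/eq_mkfrac; rewrite /= zh !zh.
Qed.

Lemma loc_nonzero_mulgI (x : loc) : ~ zset loc x -> injective (fun y => x * y).
Proof.
rewrite (mkfrac_repr x); move: (repr x).1 (repr x).2 => h s nx y z.
have nh : ~ zset H h by move=> zh; apply: nx; exact: zset_mkfrac.
have ns : ~ zset H (val s) by exact: (@frac_nz (h, s)).
rewrite (mkfrac_repr y) (mkfrac_repr z).
move: (repr y).1 (repr y).2 (repr z).1 (repr z).2 => k u l v.
rewrite !mkfracM => /eq_mkfrac; rewrite /= (mulgACA4 h k) (mulgACA4 h l) => e.
by apply/eq_mkfrac; apply: (nonzero_mulgI _ (nonzeroM nh ns)).
Qed.

HB.instance Definition _ :=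
  isCancelMonoid.Build loc locmulC loc_nontrivial loc_nonzero_mulgI.

End Localization.

Section Ideals.
Variable H : cancelMonoidType.
Implicit Types X Y A I J P M : set H.

Definition nonzero_denom : denom H :=
  @Denom H (~` zset H) (@nonzero1 H) (@nonzeroM H) (fun _ nx => nx).

(* the quotient monoid G; H is identified with its image under toG *)
Definition quot : cancelMonoidType := loc nonzero_denom.
Definition toG : H -> quot := @toloc H nonzero_denom.

(* H = G *)
Definition is_quot : Prop := range toG = [set: quot].

Definition mulset X Y : set H := [set x * y | x in X & y in Y].

Definition s_ideal X : Prop := X = mulset X setT `|` zset H.

Definition rad X : set H := [set x | exists2 n, (0 < n)%N & X (x ^+ n)].

Definition radical X : Prop := rad X = X.

(* is_subset1 A: A has at most one element; A empty gives the principal ideal z(H) *)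
Definition principal X : Prop :=
  exists A, is_subset1 A /\ X = mulset A setT `|` zset H.

Definition nontrivial X : Prop := zset H `<` X.

Definition prime_s_ideal P : Prop :=
  [/\ s_ideal P, P <> setT & forall x y, P (x * y) -> P x \/ P y].

Definition inv_set (Y : set quot) : set quot :=
  [set z | forall y, Y y -> range toG (z * y)].

(* For X included in H, 1 is in X^-1 and thus X_v is included in H, so taking *)
(* the preimage under toG loses nothing.                                      *)
Definition v_op X : set H := toG @^-1` inv_set (inv_set (toG @` X)).

Definition t_op X : set H :=
  if pselect is_quot then
    if pselect (X `<=` zset H) then zset H else setT
  else \bigcup_(E in [set E | E `<=` X /\ finite_set E]) v_op E.

Definition t_ideal X : Prop := t_op X = X.

(* X X^-1, which is a subset of H by definition of X^-1 *)
Definition mul_inv X : set H :=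
  [set h | exists x y, [/\ X x, inv_set (toG @` X) y & toG h = toG x * y]].

Definition t_invertible X : Prop := t_ideal X /\ t_op (mul_inv X) = setT.

Definition t_fin_gen I : Prop :=
  t_ideal I /\ exists E, [/\ E `<=` I, finite_set E & I = t_op E].

(* The empty t-product is {1}_t = H, which is a radical t-ideal itself, so    *)
(* allowing it in finite t-products is harmless.                              *)
Definition t_prod (Is : seq (set H)) : set H :=
  t_op (\big[mulset/[set 1]]_(I <- Is) I).

Definition radical_t_ideal I : Prop := t_ideal I /\ radical I.

Definition radical_factorization I (Is : seq (set H)) : Prop :=
  {in Is, forall J, radical_t_ideal J} /\ I = t_prod Is.

Definition pairwise_comparable (Is : seq (set H)) : Prop :=
  {in Is &, forall I J, I `<=` J \/ J `<=` I}.

Definition t_max M : Prop :=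
  [/\ t_ideal M, M <> setT &
      forall N, t_ideal N -> N <> setT -> M `<=` N -> N = M].

Definition t_SP_monoid : Prop :=
  forall I, t_ideal I -> exists Is, radical_factorization I Is.

Definition t_finite_conductor : Prop :=
  forall x y, t_fin_gen (mulset [set x] setT `&` mulset [set y] setT).

Lemma toGM x y : toG (x * y) = toG x * toG y.
Proof. exact: (toloc_monoid_morphism nonzero_denom).2. Qed.

Lemma range_toGM u v : range toG u -> range toG v -> range toG (u * v).
Proof. by move=> [x _ <-] [y _ <-]; exists (x * y); rewrite ?toGM. Qed.

Lemma sub_v_op X : X `<=` v_op X.
Proof. by move=> x Xx y Yy; rewrite mulgC; apply: Yy; exists x. Qed.

Lemma v_op_min X Y : X `<=` v_op Y -> v_op X `<=` v_op Y.
Proof.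
move=> XY x vx y Yy; apply: vx => _ [w Xw <-].
by rewrite mulgC; exact: XY.
Qed.

Lemma v_opMr X x y : v_op X x -> v_op X (x * y).
Proof.
move=> vx w Xw; rewrite toGM -mulgA (mulgC (toG y)) mulgA.
by apply: range_toGM; [exact: vx|exists y].
Qed.

Lemma zset_v_op X : zset H `<=` v_op X.
Proof.
move=> z zz w _; exists z => //.
by rewrite [RHS](zset_mkfrac (S := nonzero_denom) _ zz).
Qed.

Lemma v_opMl X x y : v_op X y -> v_op (mulset [set x] X) (x * y).
Proof.
move=> vy w Xw; rewrite toGM (mulgC (toG x)) -mulgA; apply: vy => _ [v Xv <-].
rewrite (mulgC (toG x)) -mulgA -toGM; apply: Xw.
by exists (x * v) => //; exists x => //; exists v.
Qed.

Lemma t_opE : ~ is_quot ->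
  forall X, t_op X = \bigcup_(E in [set E | E `<=` X /\ finite_set E]) v_op E.
Proof. by rewrite /t_op; case: pselect. Qed.

Lemma sub_t_op X : ~ is_quot -> X `<=` t_op X.
Proof.
move=> ng x Xx; rewrite (t_opE ng); exists [set x]; last exact: sub_v_op.
by split=> [_ ->|]; last exact: finite_set1.
Qed.

Lemma t_ideal_t_op X : ~ is_quot -> t_ideal (t_op X).
Proof.
move=> ng; apply/seteqP; split; last exact: sub_t_op.
move=> x; rewrite {1}(t_opE ng) => -[E [EX finE] vEx].
have /choice [F FP] : forall e, exists F,
    E e -> [/\ F `<=` X, finite_set F & v_op F e].
  move=> e; have [Ee|nE] := pselect (E e); last by exists set0.
  by move: (EX e Ee); rewrite (t_opE ng) => -[F [FX finF] vF]; exists F.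
rewrite (t_opE ng); exists (\bigcup_(e in E) F e).
  split=> [y [e Ee]|]; first by have [FX _ _] := FP e Ee; exact: FX.
  by apply: bigcup_finite => // e /FP[].
apply: v_op_min vEx => e Ee; have [_ _] := FP e Ee.
apply: v_op_min => y Fy; apply: sub_v_op; by exists e.
Qed.

Lemma zset_prime : prime_s_ideal (zset H).
Proof.
split.
- apply/seteqP; split=> [z zz|z]; first by right.
  by case=> // -[y zy [w _ <-]]; rewrite zy.
- by move=> e; apply: (@nonzero1 H); rewrite e.
- move=> x y zxy; have [zx|nx] := pselect (zset H x); first by left.
  by right; apply: contrapT => ny; exact: nonzeroM zxy.
Qed.

Lemma t_ideal_s_ideal X : ~ is_quot -> t_ideal X -> s_ideal X.
Proof.
move=> ng tX; apply/seteqP; split=> [x Xx|x].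
  by left; exists x => //; exists 1 => //; rewrite mulg1.
rewrite -tX (t_opE ng) => -[[y [E EX vy] [h _ <-]]|zx].
  by exists E => //; exact: v_opMr.
by exists set0; [split=> //; exact: finite_set0|exact: zset_v_op].
Qed.

Lemma t_max_prime M : t_max M -> prime_s_ideal M.
Proof.
move=> [tM nM maxM]; have [g|ng] := pselect is_quot.
  have -> : M = zset H; last exact: zset_prime.
  move: tM nM; rewrite /t_ideal /t_op; case: pselect => // ?.
  by case: pselect => ? <- nM //; case: nM.
have sM := t_ideal_s_ideal ng tM.
have MMr x y : M x -> M (x * y).
  by move=> Mx; rewrite sM; left; exists x => //; exists y.
have full x : ~ M x ->
    exists E, [/\ E `<=` M `|` [set x], finite_set E & v_op E 1].
  move=> nx; suff : t_op (M `|` [set x]) 1.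
    by rewrite (t_opE ng) => -[E [? ?] ?]; exists E.
  have sub := @sub_t_op (M `|` [set x]) ng.
  have [->//|neq] := pselect (t_op (M `|` [set x]) = setT).
  have e : t_op (M `|` [set x]) = M.
    apply: maxM => //; first exact: t_ideal_t_op.
    by move=> y My; apply: sub; left.
  by case: nx; have := sub x (or_intror erefl); rewrite e.
split=> // x y Mxy; apply: contrapT => /not_orP[/full[E [EM finE E1]]].
move=> /full[F [FM finF F1]]; apply: nM; suff M1 : M 1.
  by apply/seteqP; split=> // h _; rewrite -(mul1g h); exact: MMr.
rewrite -tM (t_opE ng); exists (mulset E F).
  split; last exact: finite_image2.
  move=> _ [e /EM[Me|->] [f /FM[Mf|->] <-]] //; try exact: MMr.
  by rewrite mulgC; exact: MMr.
apply: v_op_min E1 => e Ee; rewrite -(mulg1 e).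
suff sub : mulset [set e] F `<=` v_op (mulset E F).
  exact: v_op_min sub _ (v_opMl F1).
by move=> _ [_ -> [f Ff <-]]; apply: sub_v_op; exists e => //; exists f.
Qed.

End Ideals.

Arguments is_quot H : clear implicits.
Arguments t_SP_monoid H : clear implicits.
Arguments t_finite_conductor H : clear implicits.

Definition DVM (H : cancelMonoidType) : Prop :=
  ~ is_quot H /\ forall X : set H, s_ideal X -> principal X.

Section LocalizationAtPrime.
Variables (H : cancelMonoidType) (P : set H) (primeP : prime_s_ideal P).

Lemma prime_setC1 : (~` P) 1.
Proof.
case: primeP => sP nP _ P1; apply: nP; apply/seteqP; split=> // x _.
by rewrite sP; left; exists 1 => //; exists x; rewrite ?mul1g.
Qed.

Lemma prime_setCM x y : (~` P) x -> (~` P) y -> (~` P) (x * y).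
Proof. by case: primeP => _ _ p nx ny /p[]. Qed.

Lemma prime_setC_nz x : (~` P) x -> ~ zset H x.
Proof. by case: primeP => sP _ _ nx zx; apply: nx; rewrite sP; right. Qed.

Definition prime_denom : denom H :=
  Denom prime_setC1 prime_setCM prime_setC_nz.

Definition loc_at : cancelMonoidType := loc prime_denom.

End LocalizationAtPrime.

Definition t_almost_Dedekind (H : cancelMonoidType) : Prop :=
  is_quot H \/ forall M (maxM : t_max M), DVM (@loc_at H M (t_max_prime maxM)).

(* Main.v *)
Require Import Defs.
From mathcomp Require Import all_boot.
From mathcomp Require Import all_classical.

Set Implicit Arguments.
Unset Strict Implicit.
Unset Printing Implicit Defensive.

(** If every nonzero element of H is a unit, z(H) and H are the only t-ideals
and all four conditions hold. Otherwise the argument takes place inside H. A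
fraction p / q lies in the inverse of X exactly when q divides p x for all x in
X, so X_v is described by divisibility ([v_opP]), and X is t-invertible exactly
when (X J)_t = xH for some J and some nonzero x ([tinv], [t_invertibleP]).
Equality of t-ideals can be tested at the maximal t-ideals M ([t_ideal_local]),
where being local means: after multiplication by some s outside M.

The hub is the fourth condition, on radicals of principal ideals. It follows
from each of the others.

- From the first or the second. Call H t-valuative if any two nonzero elements
  are comparable for divisibility locally at each maximal t-ideal. Then finite
  sets with a nonzero element are t-invertible, and so is the intersection of
  two t-invertible t-ideals I and J, because the t-product of their
  intersection and their union is that of I and J ([tinv_setI]). Now the
  radical of a t-product of radical t-ideals is their intersection, and the
  factors of a principal ideal are t-invertible ([valuative_rad_tinv]).
  Discrete valuation monoids at the maximal t-ideals make H t-valuative. Under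
  the second condition, factoring principal ideals into radical ones forces H
  to be completely integrally closed ([completely_integrally_closed]); hence
  the t-finitely generated t-ideal xH cap yH is t-invertible, and so is {x, y}
  ([conductor_valuative]).

- From the third. The radical of a t-product of a chain of radical t-ideals is
  the least of them, and a factor of a principal ideal is t-invertible
  ([comparable_rad_tinv]).

Conversely, assume the fourth condition. If x and y are nonzero elements of a
maximal t-ideal M, then rad(xH) and rad(yH) coincide locally at M
([rad_local_sub]): with L = rad(xyH) and I = rad(xH), write L = (I A)_t; as L
is radical, the intersection of I and A is contained in L, so that I and A are
t-coprime ([coprime_factors]), and since I is contained in M, A is not.
Therefore a local generator a of rad(xH) divides every element of M locally,
and every nonzero element is locally a power of a times a unit
([local_uniformizer]). This gives the discrete valuation monoids of the first
condition, and shows that H is t-valuative, hence satisfies the conductor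
condition.

To factor a t-ideal I, split off its radical D, leaving the residual ideal (I :
D). At each maximal t-ideal that contains I, D is locally rad(xH) for any
nonzero x in I, so (I : D) = (I : rad(xH)) and I = (D (I : D))_t
([residual_factor]). Each step lowers the exponent of I at these maximal
t-ideals by one. If the process did not stop, the union of the residual ideals
would be contained in one maximal t-ideal M; but the exponent at M of a single
element of I is already finite ([residual_terminates]). The radicals split off
increase, so they form a chain. *)

(** * Equations in commutative monoids *)

Section CommutativeMonoidSolver.
Variables (T : Type) (op : T -> T -> T) (one : T).
Hypotheses (opA : associative op) (opC : commutative op) (op1 : left_id one op).

Inductive mexpr := MVar of nat | MOne | MMul of mexpr & mexpr.

Fixpoint mvars e : seq nat :=
  match e with
  | MVar n => [:: n]
  | MOne => [::]
  | MMul a b => mvars a ++ mvars b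
  end.

Fixpoint meval (env : seq T) e : T :=
  match e with
  | MVar n => nth one env n
  | MOne => one
  | MMul a b => op (meval env a) (meval env b)
  end.

(** A product depends only on the multiset of its factors; on lists of indices,
equality of multisets is decided by computation. *)
Lemma meval_perm env e f :
  perm_eq (mvars e) (mvars f) -> meval env e = meval env f.
Proof.
pose ev s := foldr (fun n y => op (nth one env n) y) one s.
have op1r : right_id one op by move=> x; rewrite opC op1.
have ev_cat s u : ev (s ++ u) = op (ev s) (ev u).
  by elim: s => [|n s IH] /=; rewrite ?op1 // IH opA.
have evE g : meval env g = ev (mvars g).
  by elim: g => [n||a IHa b IHb] //=; rewrite ?op1r // ev_cat IHa IHb.
rewrite !evE; elim: (mvars e) (mvars f) => [|n s IH] u.
  by move/perm_size; case: u.
move=> nsu; have nu : n \in u by rewrite -(perm_mem nsu) mem_head.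
case/splitPr: nu nsu => u1 u2; rewrite perm_sym -cat1s perm_catCA cat1s.
rewrite perm_cons perm_sym => /IH; rewrite /= => ->; rewrite !ev_cat /=.
by rewrite !opA (opC (ev u1)).
Qed.

End CommutativeMonoidSolver.

(* Atoms are compared up to conversion, because one product may occur with *)
(* several paths in the hierarchy of structures. *)
Ltac env_index x env :=
  match env with
  | cons ?y _ => let _ := match goal with _ => unify x y end in constr:(O)
  | cons _ ?env' => let n := env_index x env' in constr:(S n)
  end.

Ltac env_add x env :=
  match goal with
  | _ => let _ := env_index x env in env
  | _ => constr:(cons x env)
  end.

Ltac env_of t env :=
  lazymatch t with
  | @mul _ ?a ?b => let env' := env_of a env in env_of b env'
  | @mulset _ ?a ?b => let env' := env_of a env in env_of b env'
  | @monoid.one _ => env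
  | set1 (@monoid.one _) => env
  | _ => env_add t env
  end.

Ltac quote_mexpr t env :=
  lazymatch t with
  | @mul _ ?a ?b =>
      let a' := quote_mexpr a env in
      let b' := quote_mexpr b env in constr:(MMul a' b')
  | @mulset _ ?a ?b =>
      let a' := quote_mexpr a env in
      let b' := quote_mexpr b env in constr:(MMul a' b')
  | @monoid.one _ => constr:(MOne)
  | set1 (@monoid.one _) => constr:(MOne)
  | _ => let n := env_index t env in constr:(MVar n)
  end.

(** Proves an equation that holds in every commutative monoid, for the product
of elements of H and for the product of subsets of H. *)
Ltac cmonoid_by eval_perm :=
  lazymatch goal with
  | |- @eq ?T ?x ?y =>
      let env0 := env_of x (@nil T) in
      let env := env_of y env0 in
      let ex := quote_mexpr x env in
      let ey := quote_mexpr y env in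
      exact (eval_perm _ env ex ey isT)
  end.

(** * Products of sets and divisibility *)

Section Products.
Local Open Scope group_scope.
Local Open Scope classical_set_scope.
Variable H : cancelMonoidType.
Implicit Types (x y z p q : H) (X Y Z : set H).

Definition dvd q x : Prop := exists h, x = q * h.

Lemma mulsetP X Y z : mulset X Y z <-> exists x y, [/\ X x, Y y & z = x * y].
Proof.
split=> [[x Xx [y Yy <-]]|[x [y [Xx Yy ->]]]]; first by exists x, y.
by exists x => //; exists y.
Qed.

Lemma mem_mulset X Y x y : X x -> Y y -> mulset X Y (x * y).
Proof. by move=> Xx Yy; exists x => //; exists y. Qed.

Lemma mulsetC X Y : mulset X Y = mulset Y X.
Proof.
by apply/seteqP; split=> _ [x Xx [y Yy <-]]; rewrite mulgC; apply: mem_mulset.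
Qed.

Lemma mulsetA : associative (@mulset H).
Proof.
move=> X Y Z; apply/seteqP; split.
  move=> _ [x Xx [_ [y Yy [z Zz <-]] <-]].
  by rewrite mulgA; do !apply: mem_mulset.
move=> _ [_ [x Xx [y Yy <-]] [z Zz <-]].
by rewrite -mulgA; do !apply: mem_mulset.
Qed.

Lemma mul1set : left_id [set 1] (@mulset H).
Proof.
move=> X; apply/seteqP; split=> [_ [_ -> [x Xx <-]]|x Xx].
  by rewrite mul1g.
by rewrite -(mul1g x); apply: mem_mulset.
Qed.

Lemma mulset_sub X X' Y Y' :
  X `<=` X' -> Y `<=` Y' -> mulset X Y `<=` mulset X' Y'.
Proof. by move=> s s' _ [x /s Xx [y /s' Yy <-]]; apply: mem_mulset. Qed.

Lemma mulset11 x y : mulset [set x] [set y] = [set x * y].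
Proof.
apply/seteqP; split=> [_ [_ -> [_ -> <-]]//|_ ->].
exact: mem_mulset.
Qed.

Lemma mem_scale x X y : ~ zset H x -> mulset [set x] X (x * y) -> X y.
Proof. by move=> nx [_ -> [z Xz /(nonzero_mulgI _ nx) <-]]. Qed.

Lemma sub_scale x X Y :
  ~ zset H x -> mulset [set x] X `<=` mulset [set x] Y -> X `<=` Y.
Proof. by move=> nx s y Xy; apply/(mem_scale nx)/s/mem_mulset. Qed.

Lemma mem_pideal q x : mulset [set q] setT x <-> dvd q x.
Proof.
split=> [[_ -> [h _ <-]]|[h ->]]; first by exists h.
exact: mem_mulset.
Qed.

Lemma pideal_refl x : mulset [set x] setT x.
Proof. by apply/mem_pideal; exists 1; rewrite mulg1. Qed.

Lemma nonzero_factors x y : ~ zset H (x * y) -> ~ zset H x /\ ~ zset H y.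
Proof.
move=> nxy; split=> z; apply: nxy; first by rewrite z.
by rewrite mulgC z.
Qed.

Lemma nonzeroX x n : ~ zset H x -> ~ zset H (x ^+ n).
Proof.
move=> nx; elim: n => [|n IH]; first exact: nonzero1.
by rewrite expgS; exact: nonzeroM.
Qed.

End Products.


Definition mulg_perm (H : cancelMonoidType) :=
  meval_perm (@mulgA H) (@mulgC H) (@mul1g H).

Definition mulset_perm (H : cancelMonoidType) :=
  meval_perm (@mulsetA H) (@mulsetC H) (@mul1set H).

Ltac mulg_ac := cmonoid_by mulg_perm.
Ltac mulset_ac := cmonoid_by mulset_perm.

(** * The v-operation in terms of divisibility *)

Section QuotientMonoid.
Local Open Scope group_scope.
Local Open Scope classical_set_scope.
Variable H : cancelMonoidType.
Implicit Types (x y z p q : H) (X Y Z : set H).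

Definition nzden q (nq : ~ zset H q) : set_type (nonzero_denom H) :=
  SigSub (mem_set (nq : denom_set (nonzero_denom H) q)).

(** Divisibility is what membership of a fraction in H amounts to; this lets
the later arguments stay inside H. *)
Lemma range_frac p (s : set_type (nonzero_denom H)) x :
  range (@toG H) (mkfrac p s * toG x) <-> dvd (val s) (p * x).
Proof.
rewrite /toG /toloc mkfracM; split=> [[h _ /eq_mkfrac /=]|[h e]].
  by rewrite !mulg1 => e; exists h; rewrite -e mulgC.
by exists h => //; apply/eq_mkfrac; rewrite /= !mulg1 e mulgC.
Qed.

Lemma inv_setP X p s :
  inv_set (@toG H @` X) (mkfrac p s) <->
  forall x, X x -> dvd (val s) (p * x).
Proof.
split=> [iX x Xx|dX _ [x Xx <-]]; last exact/range_frac/dX.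
by apply/range_frac/iX; exists x.
Qed.

Lemma v_opP X y :
  v_op X y <-> forall p q, ~ zset H q ->
    (forall x, X x -> dvd q (p * x)) -> dvd q (p * y).
Proof.
split=> [vy p q nq dX|dy w].
  have := vy _ ((inv_setP _ p (nzden nq)).2 dX).
  by rewrite mulgC => /range_frac.
rewrite (mkfrac_repr w) => /inv_setP dX; rewrite mulgC.
by apply/range_frac; apply: dy => //; exact: (@frac_nz _ _ (repr w)).
Qed.

Lemma is_quotP : is_quot H <-> forall x, ~ zset H x -> exists y, x * y = 1.
Proof.
split=> [g x nx|units].
  have : range (@toG H) (mkfrac 1 (nzden nx)) by rewrite g.
  by case=> y _; rewrite /toG /toloc => /eq_mkfrac; rewrite /= !mulg1 mulgC => e; exists y.
apply/seteqP; split=> // w _; rewrite (mkfrac_repr w).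
case: (repr w) => h s; have [y sy] := units _ (@frac_nz _ _ (h, s)).
exists (h * y) => //; apply/eq_mkfrac => /=.
by rewrite mulg1 -mulgA (mulgC y) sy mulg1.
Qed.

Lemma nonunit : ~ is_quot H -> exists2 x, ~ zset H x & ~ dvd x 1.
Proof.
move=> ng; apply: contrapT => no; apply/ng/is_quotP => x nx.
apply: contrapT => ndvd; apply: no; exists x => // -[h e].
by apply: ndvd; exists h.
Qed.

End QuotientMonoid.

(** * Finite sets *)

Section FiniteSubsets.
Local Open Scope classical_set_scope.

Lemma finite_set_ind (T : eqType) (P : set T -> Prop) :
  P set0 -> (forall x E, finite_set E -> P E -> P (x |` E)) ->
  forall E, finite_set E -> P E.
Proof.
move=> P0 PU _ /finite_seqP[s ->]; elim: s => [|x s IH].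
  by rewrite (_ : [set` [::]] = set0) //; apply/seteqP; split.
rewrite (_ : [set` x :: s] = x |` [set` s]).
  by apply: PU => //; apply/finite_seqP; exists s.
apply/seteqP; split=> y; rewrite /= in_cons.
  by case/orP=> [/eqP|]; [left|right].
by case=> [->|ys]; rewrite ?eqxx ?ys ?orbT.
Qed.

Lemma finite_sub_chain (T : eqType) (F : set (set T)) (E : set T) :
  F !=set0 -> total_on F subset -> finite_set E ->
  E `<=` \bigcup_(X in F) X -> exists2 X, F X & E `<=` X.
Proof.
move=> [X0 FX0] totF fE; move: E fE.
apply: finite_set_ind => [_|x E _ IH sub]; first by exists X0.
have [Y FY Yx] := sub x (or_introl erefl).
have [|X FX EX] := IH; first by move=> y Ey; apply: sub; right.
case: (totF _ _ FX FY) => [XY|YX].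
  by exists Y => // y [->//|/EX/XY].
by exists X => // y [->|/EX//]; exact: YX.
Qed.

(** Finite subsets of an image lift to finite sets, so a finite set that
witnesses membership in a t-closure of products can be pulled back to factors.
*)
Lemma finite_sub_image (T U : eqType) (f : T -> U) (X : set T) (E : set U) :
  finite_set E -> E `<=` f @` X ->
  exists E', [/\ E' `<=` X, finite_set E' & E = f @` E'].
Proof.
move: E; apply: finite_set_ind => [_|y E _ IH sub].
  by exists set0; rewrite image_set0; split=> //; exact: finite_set0.
have [x Xx xy] := sub y (or_introl erefl).
have [|E' [E'X fE' ->]] := IH; first by move=> z Ez; apply: sub; right.
exists (x |` E'); split; first by move=> z [->//|/E'X].
  by rewrite finite_setU; split=> //; exact: finite_set1.
by rewrite image_setU image_set1 xy.
Qed.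

End FiniteSubsets.

Local Notation pideal x := (mulset [set x] setT).

(** * The t-system *)

Section TSystem.
Local Open Scope group_scope.
Local Open Scope classical_set_scope.
Variable H : cancelMonoidType.
Hypothesis ng : ~ is_quot H.
Implicit Types (x y z p q s u : H) (X Y Z I J M N : set H).

Lemma t_opP X y :
  t_op X y <-> exists E, [/\ E `<=` X, finite_set E & v_op E y].
Proof.
rewrite (t_opE ng); split=> [[E [EX fE] vE]|[E [EX fE vE]]]; exists E => //.
Qed.

Lemma t_op_idem X : t_op (t_op X) = t_op X.
Proof. exact: t_ideal_t_op. Qed.

Lemma t_opS X Y : X `<=` Y -> t_op X `<=` t_op Y.
Proof.
move=> XY y /t_opP[E [EX fE vE]]; apply/t_opP; exists E; split=> //.
exact: subset_trans XY.
Qed.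

Lemma t_op_min X Y : X `<=` t_op Y -> t_op X `<=` t_op Y.
Proof. by move/t_opS; rewrite t_op_idem. Qed.

Lemma t_op_sub X I : t_ideal I -> X `<=` I -> t_op X `<=` I.
Proof. by move=> tI /t_opS; rewrite tI. Qed.

Lemma t_idealM I x y : t_ideal I -> I x -> I (x * y).
Proof.
by move=> tI Ix; rewrite (t_ideal_s_ideal ng tI); left; apply: mem_mulset.
Qed.

Lemma t_idealMl I x y : t_ideal I -> I y -> I (x * y).
Proof. by move=> tI Iy; rewrite mulgC; exact: t_idealM. Qed.

Lemma zset_t_ideal I : t_ideal I -> zset H `<=` I.
Proof. by move=> /(t_ideal_s_ideal ng) -> z zz; right. Qed.

Lemma t_ideal_dvd I x y : t_ideal I -> I x -> dvd x y -> I y.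
Proof. by move=> tI Ix [h ->]; exact: t_idealM. Qed.

Lemma t_op_mulset X Y : mulset (t_op X) Y `<=` t_op (mulset X Y).
Proof.
move=> _ [x /t_opP[E [EX fE vE]] [y Yy <-]].
apply/t_opP; exists (mulset [set y] E); split.
- by rewrite mulsetC; apply: mulset_sub => // _ ->.
- by apply: finite_image2 => //; exact: finite_set1.
- by rewrite mulgC; exact: v_opMl.
Qed.

Lemma t_opMl X Y : t_op (mulset (t_op X) Y) = t_op (mulset X Y).
Proof.
apply/seteqP; split; first exact/t_op_min/t_op_mulset.
by apply/t_opS/mulset_sub => //; exact: sub_t_op.
Qed.

Lemma t_opMr X Y : t_op (mulset X (t_op Y)) = t_op (mulset X Y).
Proof. by rewrite mulsetC t_opMl mulsetC. Qed.

(** If E is a finite subset of xX, every element of E_v is divisible by x (take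
p = 1 and q = x), and E_v divided by x is the v-closure of E divided by x. *)
Lemma t_op_scale x X :
  ~ zset H x -> t_op (mulset [set x] X) = mulset [set x] (t_op X).
Proof.
move=> nx; apply/seteqP; split; last first.
  by rewrite mulsetC (mulsetC _ X); exact: t_op_mulset.
have -> : mulset [set x] X = (fun e => x * e) @` X.
  by apply/seteqP; split=> [_ [_ -> //]|_ [e Xe <-]]; apply: mem_mulset.
move=> y /t_opP[E0 [EX fE vE]].
have [E [{}EX {}fE eE]] := finite_sub_image fE EX.
move: vE; rewrite eE => /v_opP vE.
have [y' ey] : dvd x y.
  have := vE 1 x nx; rewrite mul1g; apply=> _ [e _ <-].
  by rewrite mul1g; exists e.
rewrite ey; apply: mem_mulset => //; apply/t_opP; exists E; split=> //.
apply/v_opP => p q nq dE; have [|h e] := vE p (q * x) (nonzeroM nq nx).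
  move=> _ [e Ee <-]; have [h eh] := dE e Ee; exists h.
  rewrite (_ : p * (x * e) = x * (p * e)); last by mulg_ac.
  by rewrite eh; mulg_ac.
exists h; apply: (nonzero_mulgI _ nx) => /=.
rewrite (_ : x * (p * y') = p * (x * y')); last by mulg_ac.
by rewrite -ey e; mulg_ac.
Qed.

(** This is where H differs from its quotient monoid: if a nonzero y were in
X_v, it would be divisible by y b for a nonzero nonunit b. *)
Lemma v_op_zset X : X `<=` zset H -> v_op X `<=` zset H.
Proof.
move=> Xz y /v_opP vy; apply: contrapT => ny.
have [b nb ndvd] := nonunit ng; apply: ndvd.
have [x /Xz zx|h] := vy 1 (y * b) (nonzeroM ny nb).
  by exists x; rewrite mul1g [RHS]mulgC zx.
rewrite mul1g -mulgA => e; exists h; apply: (nonzero_mulgI _ ny) => /=.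
by rewrite mulg1 -e.
Qed.

Lemma t_ideal_zset : t_ideal (zset H).
Proof.
apply/seteqP; split; last exact: sub_t_op.
by move=> y /t_opP[E [EX _ vE]]; exact: v_op_zset vE.
Qed.

Lemma t_ideal_pideal x : t_ideal (mulset [set x] setT).
Proof.
have [zx|nx] := pselect (zset H x).
  rewrite (_ : mulset _ _ = zset H); first exact: t_ideal_zset.
  apply/seteqP; split=> [_ [_ -> [h _ <-]]|z zz]; first by rewrite zx.
  by apply/mem_pideal; exists z; rewrite mulgC zz.
rewrite /t_ideal t_op_scale //; congr (mulset _ _).
by apply/seteqP; split=> // y _; exact: sub_t_op.
Qed.

Lemma t_op1 x : t_op [set x] = mulset [set x] setT.
Proof.
apply/seteqP; split.
  apply: t_op_sub; first exact: t_ideal_pideal.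
  by move=> _ ->; exact: pideal_refl.
move=> y /mem_pideal; apply: t_ideal_dvd; first exact: t_ideal_t_op.
exact: sub_t_op.
Qed.

Lemma t_ideal_setT : t_ideal [set: H].
Proof. by apply/seteqP; split=> // x _; exact: sub_t_op. Qed.

Lemma t_ideal_setI I J : t_ideal I -> t_ideal J -> t_ideal (I `&` J).
Proof.
move=> tI tJ; apply/seteqP; split; last exact: sub_t_op.
by move=> x tx; split; apply: t_op_sub tx => // y [].
Qed.

Lemma t_ideal_bigcup (F : set (set H)) :
  F !=set0 -> total_on F subset -> (forall X, F X -> t_ideal X) ->
  t_ideal (\bigcup_(X in F) X).
Proof.
move=> F0 totF tF; apply/seteqP; split; last exact: sub_t_op.
move=> y /t_opP[E [EX fE vE]].
have [X FX EX'] := finite_sub_chain F0 totF fE EX.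
by exists X => //; rewrite -(tF _ FX); apply/t_opP; exists E.
Qed.

Definition colon I X : set H := [set y | forall x, X x -> I (y * x)].

Lemma t_ideal_colon I X : t_ideal I -> t_ideal (colon I X).
Proof.
move=> tI; apply/seteqP; split; last exact: sub_t_op.
move=> y ty x Xx.
have : t_op (mulset (colon I X) X) (y * x).
  by apply: t_op_mulset; exact: mem_mulset.
by apply: t_op_sub => // _ [u cu [v Xv <-]]; exact: cu.
Qed.

Lemma t_ideal1 I : t_ideal I -> I 1 -> I = setT.
Proof.
move=> tI I1; apply/seteqP; split=> // x _.
by rewrite -(mul1g x); exact: t_idealM.
Qed.

(** * Maximal t-ideals *)

(** Zorn, applied to the t-ideals that contain X and avoid 1. The empty set is
adjoined to this family only to bound the empty chain. *)
Lemma t_max_exists X : ~ t_op X 1 -> exists2 M, t_max M & X `<=` M.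
Proof.
move=> nX1; pose P Y := [/\ t_ideal Y, X `<=` Y & ~ Y 1].
have [|M [PM maxM]] := @Zorn_bigcup H (fun Y => Y = set0 \/ P Y).
  move=> F FP totF.
  have [F0|/set0P F0] := eqVneq (F `\ set0) set0.
    left; apply/seteqP; split=> // x [Y FY Yx].
    suff : (F `\ set0) Y by rewrite F0.
    by split=> // Y0; rewrite Y0 in Yx.
  have FP' Y : (F `\ set0) Y -> P Y by case=> /FP[].
  right; rewrite (_ : \bigcup_(Y in F) Y = \bigcup_(Y in F `\ set0) Y); last first.
    apply/seteqP; split=> x [Y FY Yx]; last by exists Y => //; case: FY.
    by exists Y => //; split=> // Y0; rewrite Y0 in Yx.
  split.
  - apply: t_ideal_bigcup => //; last by move=> Y /FP'[].
    by move=> Y Z [FY _] [FZ _]; exact: totF.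
  - by case: F0 => Y FY x Xx; exists Y => //; have [_ + _] := FP' Y FY; apply.
  - by move=> [Y /FP'[_ _]].
have PX : P (t_op X) by split=> //; [exact: t_ideal_t_op|exact: sub_t_op].
have {}PM : P M.
  case: PM => // M0; rewrite {}M0 in maxM *.
  have [tX0|/set0P[y ty]] := eqVneq (t_op X) set0; first by rewrite -tX0.
  case: (maxM (t_op X)); last by right.
  by split=> // /(_ y ty).
have [tM XM M1] := PM; exists M => //; split=> //.
  by move=> MT; apply: M1; rewrite MT.
move=> N tN nN MN; apply/seteqP; split=> //; apply: contrapT => nNM.
apply: (maxM N); first by split.
right; split=> //; first exact: subset_trans MN.
by move=> N1; apply: nN; exact: t_ideal1.
Qed.

(** The contrapositive of the existence of maximal t-ideals, in the form used
throughout: a set that lies in no maximal t-ideal t-generates H. *)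
Lemma t_op_1 X :
  (forall M, t_max M -> exists2 x, X x & ~ M x) -> t_op X 1.
Proof.
move=> allM; apply: contrapT => /t_max_exists[M /allM[x Xx nMx] XM].
exact/nMx/XM.
Qed.

(** The elements s with s y in I form a t-ideal, which equals H as soon as it
lies in no maximal t-ideal. *)
Lemma t_ideal_local I y : t_ideal I ->
  (forall M, t_max M -> exists2 s, ~ M s & I (s * y)) -> I y.
Proof.
move=> tI allM; rewrite -(mul1g y).
suff : colon I [set y] 1 by apply.
rewrite -(t_ideal_colon _ tI); apply: t_op_1 => M /allM[s nMs Isy].
by exists s => // _ ->.
Qed.

Lemma t_max_t M : t_max M -> t_ideal M. Proof. by case. Qed.

Lemma t_maxM M s u : t_max M -> ~ M s -> ~ M u -> ~ M (s * u).
Proof. by move=> /t_max_prime[_ _ pM] ns nu /pM[]. Qed.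

Lemma t_max1 M : t_max M -> ~ M 1.
Proof. by case=> tM nM _ M1; apply: nM; exact: t_ideal1. Qed.

Lemma t_maxX M x n : t_max M -> M (x ^+ n) -> M x.
Proof.
move=> mM; apply: contraPP => nx; elim: n => [|n IH]; first exact: t_max1.
by rewrite expgS; exact: t_maxM.
Qed.

Lemma t_max_nonzero M s : t_max M -> ~ M s -> ~ zset H s.
Proof. by move=> [tM _ _] ns /(zset_t_ideal tM). Qed.

(** * t-invertibility *)

(** t-invertibility without fractions: up to t-closure, J is x times the inverse
of X. *)
Definition tinv X : Prop :=
  exists J x, ~ zset H x /\ t_op (mulset X J) = pideal x.

Lemma t_op_mulT X : t_op (mulset setT X) = t_op X.
Proof.
apply/seteqP; split; apply: t_op_min; last first.
  by move=> x Xx; apply: sub_t_op => //; rewrite -(mul1g x); exact: mem_mulset.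
move=> _ [x _ [y Xy <-]].
by apply: t_idealMl; [exact: t_op_idem|exact: sub_t_op].
Qed.

Lemma t_op_pidealM x X :
  ~ zset H x -> t_op (mulset (pideal x) X) = mulset [set x] (t_op X).
Proof. by move=> nx; rewrite -mulsetA t_op_scale // t_op_mulT. Qed.

Lemma pidealM x y : mulset (pideal x) (pideal y) = pideal (x * y).
Proof.
rewrite (_ : mulset (pideal x) _ =
  mulset (mulset [set x] [set y]) (mulset setT setT)); last by mulset_ac.
rewrite mulset11; congr (mulset _ _); apply/seteqP; split=> // z _.
by rewrite -(mul1g z); exact: mem_mulset.
Qed.

Lemma tinv_eq X Y : t_op X = t_op Y -> tinv X -> tinv Y.
Proof.
move=> e [J [x [nx eJ]]]; exists J, x; split=> //.
by rewrite -t_opMl -e t_opMl.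
Qed.

Lemma tinv_mull X Y : tinv (mulset X Y) -> tinv X.
Proof.
by move=> [J [x [nx eJ]]]; exists (mulset Y J), x; rewrite mulsetA.
Qed.

Lemma tinv_pideal x : ~ zset H x -> tinv (pideal x).
Proof.
move=> nx; exists [set 1], x; split=> //.
by rewrite mulsetC mul1set; exact: t_ideal_pideal.
Qed.

Lemma tinv_setT : tinv setT.
Proof.
apply: (@tinv_eq (pideal 1)); first by rewrite mul1set.
by apply: tinv_pideal; exact: nonzero1.
Qed.

Lemma tinvM X Y : tinv X -> tinv Y -> tinv (mulset X Y).
Proof.
move=> [J [x [nx eJ]]] [K [y [ny eK]]]; exists (mulset J K), (x * y).
split; first exact: nonzeroM.
rewrite (_ : mulset _ _ = mulset (mulset X J) (mulset Y K)); last by mulset_ac.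
by rewrite -t_opMl -t_opMr eJ eK pidealM; exact: t_ideal_pideal.
Qed.

Lemma tinv_cancel I X Y :
  tinv I -> mulset I X `<=` t_op (mulset I Y) -> X `<=` t_op Y.
Proof.
move=> [J [x [nx eJ]]] s; apply: (@sub_scale _ x) => //.
rewrite -t_op_pidealM // -eJ t_opMl.
have -> : mulset (mulset I J) Y = mulset J (mulset I Y) by mulset_ac.
rewrite -t_opMr; apply: (@subset_trans _ (t_op (mulset J (mulset I X)))).
  have -> : mulset J (mulset I X) = mulset (mulset I J) X by mulset_ac.
  rewrite -t_opMl eJ; apply: subset_trans (sub_t_op ng).
  by apply: mulset_sub => // _ ->; exact: pideal_refl.
exact/t_opS/mulset_sub.
Qed.

Lemma tinv_nonzero X : tinv X -> exists2 x, X x & ~ zset H x.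
Proof.
move=> [J [x [nx eJ]]]; apply: contrapT => no; apply: nx.
have Xz : X `<=` zset H.
  by move=> y Xy; apply: contrapT => ny; apply: no; exists y.
have : pideal x x by exact: pideal_refl.
rewrite -eJ; apply: t_op_sub; first exact: t_ideal_zset.
by move=> _ [y /Xz zy [z _ <-]]; rewrite zy.
Qed.

(** A finite subset F of IJ with x in F_v involves only a finite set E of
elements of I; then (EJ)_t = (IJ)_t, and J cancels. *)
Lemma tinv_fin_gen I :
  tinv I -> exists E, [/\ E `<=` I, finite_set E & t_op E = t_op I].
Proof.
move=> [J [x [nx eJ]]].
have : t_op (mulset I J) x by rewrite eJ; exact: pideal_refl.
have IJE : mulset I J = (fun p : (H * H)%type => p.1 * p.2) @` (I `*` J).
  apply/seteqP; split=> [_ [y Iy [z Jz <-]]|_ [[y z] [Iy Jz] <-]].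
    by exists (y, z).
  exact: mem_mulset.
rewrite IJE => /t_opP[F [FIJ fF vF]].
have [E [EIJ fE eE]] := finite_sub_image fF FIJ.
exists (fst @` E); split.
- by move=> _ [p /EIJ[Ip _] <-].
- exact: finite_image.
apply/seteqP; split; first by apply: t_opS => _ [p /EIJ[Ip _] <-].
apply: t_op_min; apply: (@tinv_cancel J).
  by exists I, x; rewrite mulsetC.
have Ex : t_op (mulset (fst @` E) J) x.
  apply/t_opP; exists F; split=> // y; rewrite eE => -[p Ep <-].
  by apply: mem_mulset; [exists p|case: (EIJ _ Ep)].
rewrite mulsetC [X in t_op X]mulsetC; apply: subset_trans (sub_t_op ng) _.
rewrite eJ => y /mem_pideal; apply: t_ideal_dvd Ex; exact: t_op_idem.
Qed.

Lemma inv_set_numerator I x (w : quot H) : I x -> ~ zset H x ->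
  inv_set (@toG H @` I) w ->
  exists2 a, colon (pideal x) I a & toG x * w = toG a.
Proof.
move=> Ix nx iy; have [a _ e] := iy _ (ex_intro2 _ _ x Ix erefl).
exists a; last by rewrite mulgC e.
move=> z Iz; apply/mem_pideal.
have [h _ eh] := iy _ (ex_intro2 _ _ z Iz erefl).
exists h; apply: (@toloc_inj _ (nonzero_denom H)).
rewrite -!/(toG _) toGM e toGM eh; mulg_ac.
Qed.

(** For a nonzero x in I, the inverse of I consists of fractions with
denominator x, whose numerators form the ideal (xH : I). *)
Lemma t_invertibleP I : t_ideal I -> (t_invertible I <-> tinv I).
Proof.
move=> tI; split=> [[_ inv]|[J [x [nx eJ]]]].
  have mul_inv_sub z : ~ zset H z -> I z ->
      mulset [set z] (mul_inv I) `<=` mulset I (colon (pideal z) I).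
    move=> nz Iz _ [_ -> [h [y [w [Iy iw e]]] <-]].
    have [a ca ea] := inv_set_numerator Iz nz iw.
    rewrite (_ : z * h = y * a); first exact: mem_mulset.
    apply: (@toloc_inj _ (nonzero_denom H)).
    rewrite -!/(toG _) !toGM e -ea; mulg_ac.
  have [x Ix nx] : exists2 x, I x & ~ zset H x.
    apply: contrapT => no; apply: (@nonzero1 H).
    have Iz : I `<=` zset H.
      by move=> y Iy; apply: contrapT => ny; apply: no; exists y.
    apply: (@t_op_sub (mul_inv I)); first exact: t_ideal_zset.
      move=> h [y [w [/Iz zy _ e]]].
      have zGy := zset_mkfrac (S := nonzero_denom H) (den1 _) zy.
      move: e; rewrite zGy => e.
      by rewrite (@toloc_inj _ (nonzero_denom H) _ _ e).
    by rewrite inv.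
  exists (colon (pideal x) I), x; split=> //; apply/seteqP; split.
    apply: t_op_sub; first exact: t_ideal_pideal.
    by move=> _ [y Iy [a ca <-]]; rewrite mulgC; exact: ca.
  have {1}-> : pideal x = t_op (mulset [set x] (mul_inv I)).
    by rewrite t_op_scale // inv.
  exact/t_opS/mul_inv_sub.
split=> //; apply: t_ideal1; first exact: t_op_idem.
have : t_op (mulset I J) x by rewrite eJ; exact: pideal_refl.
have sub : mulset I J `<=` mulset [set x] (mul_inv I).
  move=> z IJz; have : pideal x z by rewrite -eJ; exact: sub_t_op.
  case: IJz => y Iy [a Ja <-] /mem_pideal[h e]; rewrite e.
  apply: mem_mulset => //; exists y, (mkfrac a (nzden nx)); split=> //.
    apply/inv_setP => u Iu; apply/mem_pideal; rewrite -eJ.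
    by apply: sub_t_op => //; rewrite mulgC; exact: mem_mulset.
  rewrite /toG /toloc mkfracM; apply/eq_mkfrac; rewrite /= mul1g e.
  mulg_ac.
move=> /(t_opS sub); rewrite t_op_scale // -{2}(mulg1 x).
exact: mem_scale.
Qed.

End TSystem.

(** * Monoids that are locally valuation monoids *)

Section Valuative.
Local Open Scope group_scope.
Local Open Scope classical_set_scope.
Variable H : cancelMonoidType.
Hypothesis ng : ~ is_quot H.
Implicit Types (x y z p q s u : H) (X Y Z I J M N : set H).

(** The localizations at the maximal t-ideals are valuation monoids, expressed
by the elements s outside M that become units there. *)
Definition t_valuative := forall M, t_max M ->
  forall x y, ~ zset H x -> ~ zset H y ->
  exists2 s, ~ M s & dvd x (s * y) \/ dvd y (s * x).

Lemma dvd_zset x z : zset H z -> dvd x z.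
Proof. by move=> zz; exists z; rewrite mulgC zz. Qed.

Lemma zsetM x z : zset H z -> zset H (x * z).
Proof. by move=> zz y; rewrite -mulgA zz. Qed.

Lemma dvd_mull x y z : dvd x y -> dvd x (z * y).
Proof. by move=> [h ->]; exists (z * h); mulg_ac. Qed.

Lemma dvd_trans x y z : dvd x y -> dvd y z -> dvd x z.
Proof. by move=> [h ->] [k ->]; exists (h * k); mulg_ac. Qed.

Lemma dvd_mul2 x y z : dvd x y -> dvd (z * x) (z * y).
Proof. by move=> [h ->]; exists h; mulg_ac. Qed.

Lemma local_min_divisor M E : t_valuative -> t_max M -> finite_set E ->
  E `<=` zset H \/ exists e s, [/\ E e, ~ zset H e, ~ M s &
                                   forall y, E y -> dvd e (s * y)].
Proof.
move=> V mM; move: E; apply: finite_set_ind => [|x E _ IH]; first by left.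
have [zx|nx] := pselect (zset H x).
  case: IH => [Ez|[e [s [Ee ne ns dE]]]]; first by left=> y [->|/Ez].
  right; exists e, s; split=> //; first by right.
  by move=> y [->|/dE//]; apply/dvd_zset/zsetM.
right; case: IH => [Ez|[e [s [Ee ne ns dE]]]].
  exists x, 1; split=> //; [by left|exact: t_max1|].
  move=> y [->|/Ez zy]; rewrite mul1g; last exact: dvd_zset.
  by exists 1; rewrite mulg1.
have [s' ns' [dex|dxe]] := V _ mM _ _ ne nx.
  exists e, (s * s'); split=> //; [by right|exact: t_maxM|].
  move=> y [->|/dE dy]; first by rewrite -mulgA; exact: dvd_mull.
  by rewrite (mulgC s) -mulgA; exact: dvd_mull.
exists x, (s * s'); split=> //; [by left|exact: t_maxM|].
move=> y [->|/dE/(dvd_mul2 s') dy]; first by exists (s * s'); mulg_ac.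
by rewrite (mulgC s) -mulgA; exact: dvd_trans dy.
Qed.

(** Locally at M some e in E divides all of E, so E becomes principal; then E
(xH : E) contains x s for some s outside M. *)
Lemma finite_tinv E x : t_valuative -> finite_set E -> E x -> ~ zset H x ->
  tinv E.
Proof.
move=> V fE Ex nx; pose J := colon (pideal x) E.
exists J, x; split=> //; apply/seteqP; split.
  apply: (t_op_sub ng); first exact: (t_ideal_pideal ng).
  by move=> _ [y Ey [a Ja <-]]; rewrite mulgC; exact: Ja.
pose Y : set H := [set h | mulset E J (x * h)].
have Y1 : t_op Y 1.
  apply: (t_op_1 ng) => M mM.
  have [Ez|[e [s [Ee ne ns dE]]]] := local_min_divisor V mM fE.
    by case: nx; exact: Ez.
  have [a ea] := dE x Ex.
  exists s => //; rewrite /Y /= mulgC ea; apply: mem_mulset => // y Ey.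
  have [c ec] := dE y Ey; apply/mem_pideal; exists c.
  apply: (nonzero_mulgI _ ne) => /=.
  rewrite (_ : e * (a * y) = e * a * y); last by mulg_ac.
  rewrite -ea (_ : s * x * y = s * y * x); last by mulg_ac.
  by rewrite ec; mulg_ac.
have xY : mulset [set x] Y `<=` mulset E J by move=> _ [_ -> [h Yh <-]].
move=> z /mem_pideal; apply: (t_ideal_dvd ng); first exact: (t_op_idem ng).
apply: (t_opS ng xY); rewrite (t_op_scale ng) // -{2}(mulg1 x).
exact: mem_mulset.
Qed.

Lemma t_opU_idem X Y : t_op (t_op X `|` t_op Y) = t_op (X `|` Y).
Proof.
apply/seteqP; split; last first.
  by apply: (t_opS ng) => x [Xx|Yx]; [left|right]; exact: (sub_t_op ng).
apply: (t_op_min ng) => x [].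
  by apply: (t_opS ng); exact: subsetUl.
by apply: (t_opS ng); exact: subsetUr.
Qed.

Lemma tinv_setU I J : t_valuative -> tinv I -> tinv J -> tinv (I `|` J).
Proof.
move=> V iI iJ.
have [E [EI fE tE]] := tinv_fin_gen ng iI.
have [F [FJ fF tF]] := tinv_fin_gen ng iJ.
apply: (@tinv_eq _ ng (E `|` F)).
  by rewrite -[RHS]t_opU_idem -tE -tF t_opU_idem.
have [x Ex nx] : exists2 x, E x & ~ zset H x.
  have [//|x Ex nx] := @tinv_nonzero _ ng E; last by exists x.
  exact: tinv_eq iI.
apply: (@finite_tinv _ x) => //; last by left.
by rewrite finite_setU.
Qed.

(** The union U of I and J is t-invertible, and (I cap J) U has the t-closure
of IJ: one inclusion is clear, and the other follows from I J K being contained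
in x (I cap J) whenever U K is contained in xH. So the intersection is a factor
of a t-invertible ideal. *)
Lemma tinv_setI I J : t_valuative -> t_ideal I -> t_ideal J ->
  tinv I -> tinv J -> tinv (I `&` J).
Proof.
move=> V tI tJ iI iJ; have iU := tinv_setU V iI iJ.
apply: (@tinv_mull _ _ (I `|` J)).
apply: (@tinv_eq _ ng (mulset I J)); last exact: (tinvM ng).
apply/seteqP; split; last first.
  apply: (t_opS ng) => _ [x [Ix Jx] [y [Iy|Jy] <-]]; last exact: mem_mulset.
  by rewrite mulgC; exact: mem_mulset.
apply: (t_op_min ng).
have [K [x [nx eK]]] := iU.
have Kx y k : (I `|` J) y -> K k -> dvd x (y * k).
  move=> Uy Kk; apply/mem_pideal; rewrite -eK; apply: (sub_t_op ng).
  exact: mem_mulset.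
have IJK : mulset (mulset I J) K `<=` mulset [set x] (I `&` J).
  move=> _ [_ [i Ii [j Jj <-]] [k Kk <-]].
  have [c ec] := Kx i k (or_introl Ii) Kk.
  have [d ed] := Kx j k (or_intror Jj) Kk.
  rewrite (_ : i * j * k = x * (j * c)).
    apply: mem_mulset => //; split; last exact: (t_idealM ng).
    rewrite (_ : j * c = i * d); first exact: (t_idealM ng).
    apply: (nonzero_mulgI _ nx) => /=.
    rewrite (_ : x * (j * c) = j * (x * c)); last by mulg_ac.
    rewrite (_ : x * (i * d) = i * (x * d)); last by mulg_ac.
    by rewrite -ec -ed; mulg_ac.
  rewrite (_ : x * (j * c) = j * (x * c)); last by mulg_ac.
  by rewrite -ec; mulg_ac.
apply: (sub_scale nx); rewrite -(t_op_scale ng) //.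
apply: (@subset_trans _ (t_op (mulset (mulset I J) (pideal x)))).
  apply: subset_trans (sub_t_op ng).
  by rewrite mulsetC; apply: mulset_sub => // _ ->; exact: pideal_refl.
rewrite -eK (t_opMr ng); apply: (t_opS ng).
rewrite (_ : mulset _ (mulset _ K) =
  mulset (mulset (mulset I J) K) (I `|` J)); last by mulset_ac.
by rewrite mulsetA; exact: mulset_sub.
Qed.

(** * Radicals of products of radical t-ideals *)

Lemma rad_sub I J : radical J -> I `<=` J -> rad I `<=` J.
Proof. by move=> rJ IJ x [n n0 /IJ Jx]; rewrite -rJ; exists n. Qed.

Lemma sub_rad I : I `<=` rad I.
Proof. by move=> x Ix; exists 1%N. Qed.

Lemma rad_idem I : radical (rad I).
Proof.
apply/seteqP; split; last exact: sub_rad.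
move=> x [n n0 [m m0 Im]]; exists (n * m)%N; first by rewrite muln_gt0 n0.
by rewrite expgnA.
Qed.

Lemma prod_sub (Is : seq (set H)) I : {in Is, forall J, t_ideal J} ->
  I \in Is -> \big[@mulset H/[set 1]]_(J <- Is) J `<=` I.
Proof.
elim: Is => // J Is IH tIs; rewrite big_cons in_cons => /orP[/eqP->|IIs].
  move=> _ [x Jx [y _ <-]]; apply: (t_idealM ng) => //.
  by apply: tIs; rewrite mem_head.
move=> _ [x _ [y + <-]] => /IH Iy; apply: (t_idealMl ng).
  by apply: tIs; rewrite in_cons IIs orbT.
by apply: Iy => // K KIs; apply: tIs; rewrite in_cons KIs orbT.
Qed.

Lemma prod_exp (Is : seq (set H)) x : (forall I, I \in Is -> I x) ->
  (\big[@mulset H/[set 1]]_(J <- Is) J) (x ^+ size Is).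
Proof.
elim: Is => [|J Is IH] Ix; first by rewrite big_nil.
rewrite big_cons /= expgS; apply: mem_mulset; first exact: Ix (mem_head _ _).
by apply: IH => I IIs; apply: Ix; rewrite in_cons IIs orbT.
Qed.

Lemma prod_factor (Is : seq (set H)) I : I \in Is ->
  exists Y, \big[@mulset H/[set 1]]_(J <- Is) J = mulset I Y.
Proof.
elim: Is => // J Is IH; rewrite in_cons big_cons => /orP[/eqP->|/IH[Y ->]].
  by eexists.
by exists (mulset J Y); mulset_ac.
Qed.

Lemma factor_tinv x Is I : ~ zset H x ->
  radical_factorization (pideal x) Is -> I \in Is -> tinv I.
Proof.
move=> nx [_ e] /prod_factor[Y eY]; apply: (@tinv_mull _ _ Y).
exists [set 1], x; split=> //.
by rewrite mulsetC mul1set e /t_prod eY.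
Qed.

(** Each factor is radical and contains X, whence one inclusion; conversely if
y is in all n factors, then the n-th power of y is in their product. *)
Lemma rad_factorization X Is : t_ideal X ->
  radical_factorization X Is -> rad X = [set y | forall I, I \in Is -> I y].
Proof.
move=> tX [rIs eX]; apply/seteqP; split=> [y ry I IIs|y Iy].
  have [tI rI] := rIs _ IIs.
  apply: (rad_sub rI) ry; rewrite eX; apply: (t_op_sub ng) => //.
  by apply: prod_sub => // J /rIs[].
exists (size Is).+1 => //; rewrite expgS; apply: (t_idealMl ng) => //.
by rewrite eX; apply: (sub_t_op ng); exact: prod_exp.
Qed.

Lemma tinv_bigcap (Is : seq (set H)) : t_valuative ->
  (forall I, I \in Is -> t_ideal I /\ tinv I) ->
  t_ideal [set y | forall I, I \in Is -> I y] /\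
  tinv [set y | forall I, I \in Is -> I y].
Proof.
move=> V; elim: Is => [_|I Is IH tIs].
  rewrite (_ : [set y | _] = setT); last by apply/seteqP; split.
  by split; [exact: t_ideal_setT|exact: tinv_setT].
have -> : [set y | forall J, J \in I :: Is -> J y] =
          I `&` [set y | forall J, J \in Is -> J y].
  apply/seteqP; split=> y.
    move=> Iy; split; first exact: Iy (mem_head _ _).
    by move=> J JIs; apply: Iy; rewrite in_cons JIs orbT.
  by move=> [Iy Isy] J; rewrite in_cons => /orP[/eqP->|/Isy].
have [tI iI] := tIs _ (mem_head _ _).
have [|tJ iJ] := IH.
  by move=> J JIs; apply: tIs; rewrite in_cons JIs orbT.
by split; [exact: t_ideal_setI|exact: tinv_setI].
Qed.

Lemma nontrivial_principal I : principal I -> nontrivial I ->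
  exists2 x, ~ zset H x & I = pideal x.
Proof.
move=> [A [A1 eI]] [_ nI]; have [x Ax nx] : exists2 x, A x & ~ zset H x.
  apply: contrapT => no; apply: nI; rewrite eI => y [|//].
  move=> [a Aa [h _ <-]]; rewrite mulgC; apply: zsetM.
  by apply: contrapT => na; apply: no; exists a.
have eA : A = [set x] by apply/seteqP; split=> [y Ay|_ ->//]; exact: A1.
exists x => //; rewrite eI eA; apply/seteqP; split=> [y [//|zy]|y]; last by left.
by apply: (zset_t_ideal ng) zy; exact: t_ideal_pideal.
Qed.

Lemma principal_t_ideal I : principal I -> t_ideal I.
Proof.
move=> [A [A1 ->]]; have [[x Ax]|no] := pselect (exists x, A x).
  have -> : A = [set x] by apply/seteqP; split=> [y Ay|_ ->//]; exact: A1.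
  rewrite setUidl; first exact: t_ideal_pideal.
  by apply: (zset_t_ideal ng); exact: t_ideal_pideal.
rewrite (_ : mulset A _ = set0) ?set0U; first exact: t_ideal_zset.
by apply/seteqP; split=> // y [x Ax _]; case: no; exists x.
Qed.

(** The form of [rad_t_invertible] used in the proofs: on generators, and
without fractions. *)
Definition rad_tinv := forall x, ~ zset H x ->
  t_ideal (rad (pideal x)) /\ tinv (rad (pideal x)).

Definition rad_t_invertible :=
  forall I, principal I -> nontrivial I -> t_invertible (rad I).

Lemma principal_pideal x : principal (pideal x).
Proof.
exists [set x]; split; first by move=> ? ? -> ->.
apply/seteqP; split=> [y|y [//|zy]]; first by left.
by apply: (zset_t_ideal ng) zy; exact: t_ideal_pideal.
Qed.

Lemma rad_t_invertibleP : rad_t_invertible <-> rad_tinv.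
Proof.
split=> [r4 x nx|r I /nontrivial_principal/[apply][[x nx ->]]]; last first.
  by have [t i] := r x nx; exact/(t_invertibleP ng).
have /[dup][[t _]] : t_invertible (rad (pideal x)).
  apply: r4; first exact: principal_pideal.
  split; first by apply: (zset_t_ideal ng); exact: t_ideal_pideal.
  by move=> s; apply/nx/s/pideal_refl.
by move/(t_invertibleP ng t).
Qed.

Lemma valuative_rad_tinv : t_valuative ->
  (forall I, principal I -> exists Is, radical_factorization I Is) -> rad_tinv.
Proof.
move=> V fac x nx; have [Is fIs] := fac _ (principal_pideal x).
rewrite (rad_factorization _ fIs); last exact: t_ideal_pideal.
apply: tinv_bigcap => // I IIs; split; last exact: factor_tinv fIs IIs.
by case: fIs => /(_ _ IIs)[].
Qed.

Lemma comparable_least (Is : seq (set H)) : pairwise_comparable Is ->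
  Is = [::] \/ exists2 I, I \in Is & forall J, J \in Is -> I `<=` J.
Proof.
elim: Is => [|I Is IH] cIs; first by left.
right; case: IH => [J K JIs KIs|->|[J JIs Jmin]].
- by apply: cIs; rewrite in_cons ?JIs ?KIs orbT.
- by exists I; [exact: mem_head|move=> J; rewrite inE => /eqP->].
have [||IJ|JI] := cIs I J; rewrite ?mem_head // ?in_cons ?JIs ?orbT //.
  exists I; first exact: mem_head.
  move=> K; rewrite in_cons => /orP[/eqP->//|/Jmin].
  exact: subset_trans.
exists J; first by rewrite in_cons JIs orbT.
by move=> K; rewrite in_cons => /orP[/eqP->//|/Jmin].
Qed.

Lemma comparable_rad_tinv :
  (forall I, t_ideal I ->
     exists Is, radical_factorization I Is /\ pairwise_comparable Is) ->
  rad_tinv.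
Proof.
move=> fac x nx; have tx := t_ideal_pideal ng x.
have [Is [fIs cIs]] := fac _ tx; rewrite (rad_factorization tx fIs).
case: (comparable_least cIs) => [->|[I IIs Imin]].
  rewrite (_ : [set y | _] = setT); last by apply/seteqP; split.
  by split; [exact: t_ideal_setT|exact: tinv_setT].
rewrite (_ : [set y | _] = I).
  split; last exact: factor_tinv fIs IIs.
  by case: fIs => /(_ _ IIs)[].
by apply/seteqP; split=> [y /(_ I IIs)//|y Iy J /Imin]; apply.
Qed.

End Valuative.

(** * Local structure when radicals of principal ideals are t-invertible *)

Section RadicalsInvertible.
Local Open Scope group_scope.
Local Open Scope classical_set_scope.
Variable H : cancelMonoidType.
Hypothesis ng : ~ is_quot H.
Implicit Types (x y z p q s u w : H) (X Y Z I J L M N : set H).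

(** To contain is to divide, for t-invertible ideals. *)
Lemma colon_factor I L : tinv I -> t_ideal L -> L `<=` I ->
  t_op (mulset I (colon L I)) = L.
Proof.
move=> iI tL LI; apply/seteqP; split.
  apply: (t_op_sub ng) => // _ [i Ii [y cy <-]].
  by rewrite mulgC; exact: cy.
have [K [c [nc eK]]] := iI.
have KI i k : I i -> K k -> dvd c (i * k).
  move=> Ii Kk; apply/mem_pideal; rewrite -eK; apply: (sub_t_op ng).
  exact: mem_mulset.
have LK : mulset L K `<=` mulset [set c] (colon L I).
  move=> _ [l Ll [k Kk <-]]; have [y ey] := KI _ _ (LI _ Ll) Kk.
  rewrite ey; apply: mem_mulset => // i Ii; have [h eh] := KI _ _ Ii Kk.
  rewrite (_ : y * i = l * h); first exact: (t_idealM ng).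
  apply: (nonzero_mulgI _ nc) => /=.
  rewrite (_ : c * (y * i) = c * y * i); last by mulg_ac.
  rewrite -ey (_ : l * k * i = l * (i * k)); last by mulg_ac.
  by rewrite eh; mulg_ac.
apply: (sub_scale nc); rewrite -(t_op_scale ng) //.
apply: (@subset_trans _ (t_op (mulset L (pideal c)))).
  apply: subset_trans (sub_t_op ng).
  by rewrite mulsetC; apply: mulset_sub => // _ ->; exact: pideal_refl.
rewrite -eK (t_opMr ng); apply: (t_opS ng).
rewrite (_ : mulset L _ = mulset I (mulset L K)); last by mulset_ac.
rewrite (_ : mulset [set c] _ = mulset I (mulset [set c] (colon L I))).
  exact: mulset_sub.
by mulset_ac.
Qed.

Lemma t_op_dvd X y p q : ~ zset H q -> t_op X y ->
  (forall x, X x -> dvd q (p * x)) -> dvd q (p * y).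
Proof.
move=> nq /(t_opP ng)[E [EX _ /v_opP vE]] dX.
by apply: vE => // x /EX; exact: dX.
Qed.

(** If q divides p I and p J, then p i = q h and p j = q k give j h = i k in
the intersection of I and J, so p IJ is contained in q (IJ)_t; cancelling the
t-invertible IJ shows that q divides p. This applies to finite t-generating
sets of I and J as well, so the v-closure of their union contains 1. *)
Lemma coprime_factors I J : tinv I -> tinv J -> t_ideal I -> t_ideal J ->
  I `&` J `<=` t_op (mulset I J) -> t_op (I `|` J) 1.
Proof.
move=> iI iJ tI tJ IJ.
have [E [EI fE tE]] := tinv_fin_gen ng iI.
have [F [FJ fF tF]] := tinv_fin_gen ng iJ.
suff : t_op (E `|` F) 1.
  by apply: (t_opS ng) => x [/EI|/FJ]; [left|right].
apply/(t_opP ng); exists (E `|` F); split=> //; first by rewrite finite_setU.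
apply/v_opP => p q nq dEF; rewrite mulg1.
have dI i : I i -> dvd q (p * i).
  move=> Ii; apply: (t_op_dvd nq (X := E)); first by rewrite tE tI.
  by move=> e Ee; apply: dEF; left.
have dJ j : J j -> dvd q (p * j).
  move=> Jj; apply: (t_op_dvd nq (X := F)); first by rewrite tF tJ.
  by move=> e Fe; apply: dEF; right.
have sub : mulset [set p] (mulset I J) `<=`
           mulset [set q] (t_op (mulset I J)).
  move=> _ [_ -> [_ [i Ii [j Jj <-]] <-]].
  have [h eh] := dI _ Ii; have [k ek] := dJ _ Jj.
  rewrite (_ : p * (i * j) = q * (j * h)).
    apply: mem_mulset => //; apply: IJ; split; last exact: (t_idealM ng).
    rewrite (_ : j * h = i * k); first exact: (t_idealM ng).
    apply: (nonzero_mulgI _ nq) => /=.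
    rewrite (_ : q * (j * h) = j * (q * h)); last by mulg_ac.
    rewrite (_ : q * (i * k) = i * (q * k)); last by mulg_ac.
    by rewrite -eh -ek; mulg_ac.
  rewrite (_ : q * (j * h) = j * (q * h)); last by mulg_ac.
  by rewrite -eh; mulg_ac.
have iIJ := tinvM ng iI iJ.
apply/mem_pideal; rewrite -(t_op1 ng) /=.
suff : [set p] `<=` t_op [set q] by apply.
apply: (tinv_cancel ng iIJ); rewrite mulsetC; apply: subset_trans sub _.
by rewrite (mulsetC _ [set q]) t_op_scale.
Qed.

Lemma rad_mono X Y : X `<=` Y -> rad X `<=` rad Y.
Proof. by move=> XY x [n n0 /XY Yx]; exists n. Qed.

Lemma expMn x y n : (x * y) ^+ n = x ^+ n * y ^+ n.
Proof. by rewrite expgMn //; exact: mulgC. Qed.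

Lemma rad_t_max M X : t_max M -> X `<=` M -> rad X `<=` M.
Proof. by move=> mM XM x [n _ /XM /(t_maxX ng mM)]. Qed.

Lemma pideal_t_max M x : t_max M -> M x -> pideal x `<=` M.
Proof. by move=> [tM _ _] Mx y /mem_pideal; exact: (t_ideal_dvd ng). Qed.

Lemma pideal_mull x y : pideal (x * y) `<=` pideal x.
Proof. by move=> _ /mem_pideal[h ->]; apply/mem_pideal; exists (y * h); mulg_ac. Qed.

(** With (IK)_t = cH, the elements h with c h in IK t-generate H, so one of
them is outside M; writing c h = a k, the element a generates I at M. *)
Lemma local_generator M I : t_max M -> tinv I ->
  exists a s, [/\ I a, ~ zset H a, ~ M s & forall w, I w -> dvd a (s * w)].
Proof.
move=> mM [K [c [nc eK]]].
pose Y : set H := [set h | mulset I K (c * h)].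
have KI i k : I i -> K k -> dvd c (i * k).
  move=> Ii Kk; apply/mem_pideal; rewrite -eK; apply: (sub_t_op ng).
  exact: mem_mulset.
have Y1 : t_op Y 1.
  apply: (mem_scale nc); rewrite mulg1 -(t_op_scale ng) //.
  have sub : mulset I K `<=` mulset [set c] Y.
    move=> _ [i Ii [k Kk <-]]; have [h eh] := KI _ _ Ii Kk.
    by rewrite eh; apply: mem_mulset => //; rewrite /Y /= -eh; exact: mem_mulset.
  by apply: (t_opS ng sub); rewrite eK; exact: pideal_refl.
have [h Yh nMh] : exists2 h, Y h & ~ M h.
  apply: contrapT => no; apply: (t_max1 ng mM).
  apply: (t_op_sub ng _ _ Y1); first exact: t_max_t.
  by move=> h Yh; apply: contrapT => nMh; apply: no; exists h.
have [a [j [Ia Kj e]]] := (mulsetP _ _ _).1 Yh.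
exists a, h; split=> //.
  have /nonzero_factors[]// : ~ zset H (a * j).
  by rewrite -e; apply: nonzeroM nc (t_max_nonzero ng mM nMh).
move=> w Iw; have [k ek] := KI _ _ Iw Kj; exists k.
apply: (nonzero_mulgI _ nc) => /=.
rewrite (_ : c * (h * w) = c * h * w); last by mulg_ac.
rewrite e (_ : c * (a * k) = a * (c * k)); last by mulg_ac.
by rewrite -ek; mulg_ac.
Qed.

Hypothesis radH : rad_tinv H.

(** The localizations at M of rad(xH) and of rad(xyH) agree, since the cofactor
A of the second in the first is not contained in M; and rad(xyH) is contained
in rad(yH). *)
Lemma rad_local_sub M x y : t_max M -> M x -> M y ->
  ~ zset H x -> ~ zset H y ->
  exists2 s, ~ M s & forall w, rad (pideal x) w -> rad (pideal y) (s * w).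
Proof.
move=> mM Mx My nx ny.
set I := rad (pideal x); set L := rad (pideal (x * y)).
have [tI iI] := radH nx; have [tL iL] := radH (nonzeroM nx ny).
have LI : L `<=` I by exact/rad_mono/pideal_mull.
have LJ : L `<=` rad (pideal y).
  by apply/rad_mono; rewrite mulgC; exact: pideal_mull.
pose A := colon L I; have tA : t_ideal A by exact: (t_ideal_colon ng).
have eL : t_op (mulset I A) = L by exact: colon_factor.
have iA : tinv A.
  apply: (@tinv_mull _ _ I); apply: (@tinv_eq _ ng L) => //.
  by rewrite mulsetC eL tL.
have IA1 : t_op (I `|` A) 1.
  apply: coprime_factors => //; rewrite eL => w [Iw Aw].
  by rewrite /L -[rad _]rad_idem; exists 2 => //; rewrite expg2; exact: Aw.
have IM : I `<=` M by apply: rad_t_max => //; exact: pideal_t_max.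
have [s As nMs] : exists2 s, A s & ~ M s.
  apply: contrapT => no; apply: (t_max1 ng mM).
  apply: (t_op_sub ng _ _ IA1); first exact: t_max_t.
  by move=> h [/IM//|Ah]; apply: contrapT => nMh; apply: no; exists h.
by exists s => // w Iw; apply/LJ/As.
Qed.

Lemma ex_last_step (P : nat -> Prop) n :
  P 0%N -> ~ P n -> exists k, P k /\ ~ P k.+1.
Proof.
move=> P0; elim: n => // n IH nP.
by have [Pn|/IH//] := pselect (P n); exists n.
Qed.

(** Let a generate rad(x0 H) at M. By [rad_local_sub] a divides locally each
nonzero x of M, and x divides a power of a locally; so there is a largest power
of a that divides x locally, and the cofactor is outside M. *)
Lemma local_uniformizer M x0 : t_max M -> M x0 -> ~ zset H x0 ->
  exists a, [/\ M a, ~ zset H a & forall x, ~ zset H x ->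
    exists k s u, [/\ ~ M s, ~ M u & s * x = a ^+ k * u]].
Proof.
move=> mM Mx0 nx0; have [tI iI] := radH nx0.
have [a [s0 [Ia na nMs0 da]]] := local_generator mM iI.
have Ma : M a by apply: rad_t_max Ia => //; exact: pideal_t_max.
exists a; split=> // x nx.
have [Mx|nMx] := pselect (M x); last first.
  by exists 0%N, 1, x; split=> //; exact: (t_max1 ng).
have up z : M z -> ~ zset H z -> exists2 s, ~ M s & dvd a (s * z).
  move=> Mz nz; have [s nMs sI] := rad_local_sub mM Mz Mx0 nz nx0.
  exists (s0 * s); first exact: (t_maxM mM).
  by rewrite -mulgA; apply/da/sI/sub_rad/pideal_refl.
have [n [s1 nMs1 dx]] : exists n, exists2 s, ~ M s & dvd x (s * a ^+ n).
  have [s nMs sI] := rad_local_sub mM Mx0 Mx nx0 nx.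
  have [n _ /mem_pideal xn] := sI a Ia.
  exists n, (s ^+ n); first by move/(t_maxX ng mM).
  by rewrite -expMn.
pose P k := exists2 s, ~ M s & dvd (a ^+ k) (s * x).
have P0 : P 0%N.
  exists 1; first exact: (t_max1 ng mM).
  by exists (1 * x); rewrite [RHS]mul1g.
(* If a^(n+1) divides s x and x divides s1 a^n, then a divides s s1, which
   is outside M. *)
have nPn : ~ P n.+1.
  move=> [s nMs das].
  have : dvd (a ^+ n.+1) (s * s1 * a ^+ n).
    apply: dvd_trans das _; rewrite -mulgA; exact: dvd_mul2.
  move=> [h]; rewrite expgS => e; apply: (t_maxM mM nMs nMs1).
  have -> : s * s1 = a * h.
    have nan : ~ zset H (a ^+ n) := nonzeroX na.
    apply: (nonzero_mulgI _ nan) => /=.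
    by rewrite mulgC e; mulg_ac.
  by apply: (t_idealM ng) => //; exact: t_max_t.
have [k [[s nMs [u eu]] nPk]] := ex_last_step P0 nPn.
exists k, s, u; split=> // Mu; apply: nPk.
have [_ nu] : ~ zset H (a ^+ k) /\ ~ zset H u.
  apply: nonzero_factors; rewrite -eu; apply: nonzeroM => //.
  exact: (t_max_nonzero ng mM).
have [t nMt dau] := up u Mu nu; exists (t * s); first exact: (t_maxM mM).
rewrite -mulgA eu expgSr (_ : t * _ = a ^+ k * (t * u)); last by mulg_ac.
exact: dvd_mul2.
Qed.

Lemma rad_tinv_valuative : t_valuative H.
Proof.
move=> M mM x y nx ny.
have [Mx|nMx] := pselect (M x); last by exists x => //; left; exists y.
have [a [_ _ val]] := local_uniformizer mM Mx nx.
have half z t k l s s' u u' : (k <= l)%N -> s * z = a ^+ k * u ->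
    s' * t = a ^+ l * u' -> dvd z (u * s' * t).
  move=> kl ez et; exists (a ^+ (l - k) * u' * s).
  have eal : a ^+ l = a ^+ k * a ^+ (l - k) by rewrite -expgnDr subnKC.
  rewrite -mulgA et eal.
  rewrite (_ : z * _ = a ^+ (l - k) * u' * (s * z)); last by mulg_ac.
  by rewrite ez; mulg_ac.
have [k [s [u [nMs nMu ex]]]] := val x nx.
have [l [t [v [nMt nMv ey]]]] := val y ny.
have [kl|/ltnW lk] := leqP k l.
  exists (u * t); first exact: (t_maxM mM).
  by left; exact: half kl ex ey.
exists (v * s); first exact: (t_maxM mM).
by right; exact: half lk ey ex.
Qed.

(** * Factorization of t-ideals *)

Definition t_rad I : set H := t_op (rad I).

(** The cofactor left when the radical is split off from I. *)
Definition residual I : set H := colon I (t_rad I).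

Lemma t_rad_ideal I : t_ideal (t_rad I).
Proof. exact: (t_op_idem ng). Qed.

Lemma sub_t_rad I : I `<=` t_rad I.
Proof. by move=> x Ix; apply/(sub_t_op ng)/sub_rad. Qed.

Lemma t_rad_t_max I M : t_max M -> I `<=` M -> t_rad I `<=` M.
Proof.
move=> mM IM; apply: (t_op_sub ng); first exact: t_max_t.
exact: rad_t_max.
Qed.

Lemma t_rad_mono I J : I `<=` J -> t_rad I `<=` t_rad J.
Proof. by move=> IJ; apply/(t_opS ng)/rad_mono. Qed.

Lemma pideal_sub I x : t_ideal I -> I x -> pideal x `<=` I.
Proof. by move=> tI Ix y /mem_pideal; exact: (t_ideal_dvd ng). Qed.

(** Locally at a maximal t-ideal that contains I, the radical of any nonzero
principal ideal in it is the same; so if a power of y is in the t-closure, y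
itself is, locally. *)
Lemma t_rad_radical I x : t_ideal I -> I x -> ~ zset H x -> radical (t_rad I).
Proof.
move=> tI Ix nx; apply/seteqP; split; last exact: sub_rad.
move=> y [n n0 Dyn]; apply: (t_ideal_local ng (t_rad_ideal I)) => M mM.
have [DM|] := pselect (t_rad I `<=` M); last first.
  move=> /existsNP[s /not_implyP[Ds nMs]]; exists s => //.
  by apply: (t_idealM ng) => //; exact: t_rad_ideal.
have My : M y by apply/(t_maxX ng mM (n := n))/DM.
have Mx : M x by apply/DM/sub_t_rad.
have [zy|ny] := pselect (zset H y).
  exists 1; first exact: (t_max1 ng).
  by rewrite mul1g; apply: (zset_t_ideal ng) zy; exact: t_rad_ideal.
have [s nMs sy] := rad_local_sub mM My Mx ny nx; exists s => //.
apply: (sub_t_op ng); apply: (rad_mono (pideal_sub tI Ix)).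
exact/sy/sub_rad/pideal_refl.
Qed.

(** A global statement from a local one: at a maximal t-ideal containing I,
every nonzero d of the radical of I is, up to some s outside M, in rad(xH). *)
Lemma colon_rad_pideal I x w : t_ideal I -> I x -> ~ zset H x ->
  colon I (rad (pideal x)) w -> residual I w.
Proof.
move=> tI Ix nx cw d Dd; apply: (t_ideal_local ng tI) => M mM.
have [IM|] := pselect (I `<=` M); last first.
  move=> /existsNP[s /not_implyP[Is nMs]]; exists s => //.
  exact: (t_idealM ng).
have Md : M d by apply: t_rad_t_max Dd.
have [zd|nd] := pselect (zset H d).
  exists 1; first exact: (t_max1 ng).
  by apply: (zset_t_ideal ng) => //; do 2 apply: zsetM.
have [s nMs sd] := rad_local_sub mM Md (IM _ Ix) nd nx; exists s => //.
rewrite (_ : s * (w * d) = w * (s * d)); last by mulg_ac.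
exact/cw/sd/sub_rad/pideal_refl.
Qed.

Lemma residual_t_ideal I : t_ideal I -> t_ideal (residual I).
Proof. exact: (t_ideal_colon ng). Qed.

Lemma sub_residual I : t_ideal I -> I `<=` residual I.
Proof. by move=> tI x Ix d _; exact: (t_idealM ng). Qed.

(** Each nonzero x in I already lies in the t-product of rad(xH) and (xH :
rad(xH)), because rad(xH) is t-invertible; by [colon_rad_pideal] the second
factor is contained in the residual ideal of I. *)
Lemma residual_factor I x0 : t_ideal I -> I x0 -> ~ zset H x0 ->
  I = t_op (mulset (t_rad I) (residual I)).
Proof.
move=> tI Ix0 nx0; apply/seteqP; split; last first.
  apply: (t_op_sub ng) => // _ [d Dd [y ry <-]].
  by rewrite mulgC; exact: ry.
move=> x Ix; have [zx|nx] := pselect (zset H x).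
  by apply: (zset_t_ideal ng) zx; exact: (t_op_idem ng).
have [tx ix] := radH nx.
have := pideal_refl x.
rewrite -(colon_factor ix (t_ideal_pideal ng x) (@sub_rad _ _)).
apply: (t_opS ng); apply: mulset_sub.
  by apply: subset_trans (sub_t_op ng); apply: rad_mono; exact: pideal_sub.
move=> w cw; apply: (colon_rad_pideal tI Ix nx) => r rr.
exact/(pideal_sub tI Ix)/cw.
Qed.

Lemma residual_iter I k : t_ideal I ->
  t_ideal (iter k residual I) /\ I `<=` iter k residual I.
Proof.
move=> tI; elim: k => [|k [tk Ik]] /=; first by split.
split; first exact: residual_t_ideal.
exact: subset_trans (sub_residual tk).
Qed.

(** Otherwise the increasing union of the residual ideals is a proper t-ideal,
contained in some M. If a generates rad(xH) at M, some power of a is in I; and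
if s times the (m+1)-st power of a is in one residual ideal, then a multiple by
an element outside M of the m-th power of a is in the next one. Descending to m
= 0 produces an element outside M in some residual ideal. *)
Lemma residual_terminates I x : t_ideal I -> I x -> ~ zset H x ->
  exists k, iter k residual I = setT.
Proof.
move=> tI Ix nx; apply: contrapT => no.
have tk k : t_ideal (iter k residual I) by case: (residual_iter k tI).
have Ik k : I `<=` iter k residual I by case: (residual_iter k tI).
pose U := \bigcup_(X in range (fun k => iter k residual I)) X.
have mono k l : (k <= l)%N -> iter k residual I `<=` iter l residual I.
  move=> kl; rewrite -(subnK kl) iterD.
  by case: (residual_iter (l - k) (tk k)).
have tU : t_ideal U.
  apply: (t_ideal_bigcup ng) => [|X Y [k _ <-] [l _ <-]|_ [k _ <-]//].
    by exists I; exists 0%N.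
  by case: (leqP k l) => [kl|/ltnW lk]; [left|right]; exact: mono.
have [M mM UM] : exists2 M, t_max M & U `<=` M.
  apply: (t_max_exists ng); rewrite tU => -[_ [k _ <-] k1].
  by apply: no; exists k; exact: (t_ideal1 ng).
have kM k : iter k residual I `<=` M.
  by move=> y ky; apply: UM; exists (iter k residual I) => //; exists k.
have [tx ix] := radH nx.
have [a [s0 [ra na nMs0 da]]] := local_generator mM ix.
have descend m : forall k s, ~ M s -> ~ iter k residual I (s * a ^+ m).
  elim: m => [|m IH] k s nMs; first by rewrite mulg1 => /kM.
  move=> ks; apply: (IH k.+1 (s * s0)); first exact: (t_maxM mM).
  apply: (colon_rad_pideal (tk k) (Ik k x Ix) nx) => r /da[h eh].
  rewrite (_ : _ * r = s * a ^+ m * (s0 * r)); last by mulg_ac.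
  rewrite eh (_ : _ * (a * h) = s * (a * a ^+ m) * h); last by mulg_ac.
  by rewrite -expgS; exact: (t_idealM ng).
have [n _ /(pideal_sub tI Ix) Ian] := ra.
by apply: (descend n 0%N 1); rewrite ?mul1g //; exact: (t_max1 ng).
Qed.

(** The radical of I is kept as a lower bound of all the factors, so that
splitting off a further radical extends the chain. *)
Lemma factor_of_terminating k I x : t_ideal I -> I x -> ~ zset H x ->
  iter k residual I = setT ->
  exists Is, [/\ radical_factorization I Is, pairwise_comparable Is &
                 {in Is, forall J, t_rad I `<=` J}].
Proof.
elim: k I => [|k IH] I tI Ix nx.
  move=> /= ->; exists [::]; split=> //; split=> //.
  by rewrite /t_prod big_nil (t_op1 ng) mul1set.
rewrite iterSr => eI.
have [Is [[rIs eIs] cIs DIs]] :=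
  IH _ (residual_t_ideal tI) (sub_residual tI Ix) nx eI.
have Dsub J : J \in Is -> t_rad I `<=` J.
  move=> /DIs; apply: subset_trans; apply: t_rad_mono; exact: sub_residual.
exists (t_rad I :: Is); split.
- split; last first.
    rewrite {1}(residual_factor tI Ix nx) eIs /t_prod big_cons.
    by rewrite (t_opMr ng).
  move=> J; rewrite in_cons => /orP[/eqP->|/rIs//].
  by split; [exact: t_rad_ideal|exact: t_rad_radical tI Ix nx].
- move=> J K; rewrite !in_cons => /orP[/eqP->|JIs] /orP[/eqP->|KIs].
  + by left.
  + by left; exact: Dsub.
  + by right; exact: Dsub.
  + exact: cIs.
- by move=> J; rewrite in_cons => /orP[/eqP->//|/Dsub].
Qed.

Lemma zset_radical : radical (zset H).
Proof.
apply/seteqP; split; last exact: sub_rad.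
move=> x [n _ zn]; apply: contrapT => nx; exact: (nonzeroX nx) zn.
Qed.

Lemma comparable_factorization I : t_ideal I ->
  exists Is, radical_factorization I Is /\ pairwise_comparable Is.
Proof.
move=> tI; have [[x Ix nx]|no] := pselect (exists2 x, I x & ~ zset H x).
  have [k ek] := residual_terminates tI Ix nx.
  by have [Is [fIs cIs _]] := factor_of_terminating tI Ix nx ek; exists Is.
have -> : I = zset H.
  apply/seteqP; split; last exact: (zset_t_ideal ng).
  by move=> x Ix; apply: contrapT => nx; apply: no; exists x.
exists [:: zset H]; split; last by move=> J K; rewrite !mem_seq1 => /eqP-> /eqP->; left.
split; first by move=> J; rewrite mem_seq1 => /eqP->; split;
  [exact: t_ideal_zset|exact: zset_radical].
by rewrite /t_prod big_cons big_nil mulsetC mul1set (t_ideal_zset ng).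
Qed.

Lemma finite_conductor : t_finite_conductor H.
Proof.
move=> x y; have tx := t_ideal_pideal ng x; have ty := t_ideal_pideal ng y.
have tI := t_ideal_setI ng tx ty; split=> //.
have [[w [xw yw] nw]|no] :=
    pselect (exists2 w, (pideal x `&` pideal y) w & ~ zset H w); last first.
  exists set0; split=> //.
  apply/seteqP; split=> [w Iw|]; last exact: (t_op_sub ng).
  apply: (zset_t_ideal ng); first exact: (t_op_idem ng).
  by apply: contrapT => nw; apply: no; exists w.
have nx : ~ zset H x.
  by case/mem_pideal: xw nw => h -> /nonzero_factors[].
have ny : ~ zset H y.
  by case/mem_pideal: yw nw => h -> /nonzero_factors[].
have iI := tinv_setI ng rad_tinv_valuative tx ty (tinv_pideal ng nx)
             (tinv_pideal ng ny).
have [E [EI fE tE]] := tinv_fin_gen ng iI.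
by exists E; split=> //; rewrite tE tI.
Qed.

End RadicalsInvertible.

(** * Complete integral closure *)

Section CompleteIntegralClosure.
Local Open Scope group_scope.
Local Open Scope classical_set_scope.
Variable H : cancelMonoidType.
Hypothesis ng : ~ is_quot H.
Implicit Types (x y z p q s u w : H) (X Y Z I J L M N : set H).
Implicit Types (Is Js : seq (set H)).

Local Notation setprod Is := (\big[@mulset H/[set 1]]_(J <- Is) J).

Definition setpow X k : set H := iter k (mulset X) [set 1].

Lemma mem_setpow X x k : X x -> setpow X k (x ^+ k).
Proof.
by move=> Xx; elim: k => //= k IH; rewrite expgS; exact: mem_mulset.
Qed.

Lemma setpowM X Y k :
  setpow (mulset X Y) k = mulset (setpow X k) (setpow Y k).
Proof.
elim: k => [|k IH] /=; first by rewrite mul1set.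
rewrite IH; mulset_ac.
Qed.

Lemma t_op_setpow X k : t_op (setpow (t_op X) k) = t_op (setpow X k).
Proof.
by elim: k => //= k IH; rewrite (t_opMl ng) -(t_opMr ng) IH (t_opMr ng).
Qed.

Lemma setpow1 x k : setpow [set x] k = [set x ^+ k].
Proof. by elim: k => //= k ->; rewrite mulset11 expgS. Qed.

Lemma t_op_setpow_inverse I K d k : t_op (mulset I K) = pideal d ->
  t_op (mulset (setpow I k) (setpow K k)) = pideal (d ^+ k).
Proof.
move=> e; rewrite -setpowM -t_op_setpow e -(t_op1 ng) t_op_setpow setpow1.
exact: t_op1.
Qed.

(** A t-invertible t-ideal is divisorial. *)
Lemma mem_by_inverse I K d w : t_ideal I -> ~ zset H d ->
  t_op (mulset I K) = pideal d -> (forall k, K k -> dvd d (w * k)) -> I w.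
Proof.
move=> tI nd eK dw; apply: (mem_scale nd).
rewrite -tI -(t_op_scale ng) //.
have sub : mulset [set w] (mulset I K) `<=` mulset [set d] I.
  move=> _ [_ -> [_ [i Ii [k Kk <-]] <-]]; have [h eh] := dw k Kk.
  rewrite (_ : w * (i * k) = i * (w * k)); last by mulg_ac.
  rewrite eh (_ : i * (d * h) = d * (i * h)); last by mulg_ac.
  by apply: mem_mulset => //; exact: (t_idealM ng).
apply: (t_opS ng sub); rewrite -(t_opMr ng) eK mulgC; apply: (sub_t_op ng).
by apply: mem_mulset => //; exact: pideal_refl.
Qed.

Definition tinv_radical I := [/\ t_ideal I, radical I & tinv I].

(** Induction on the number of factors of C = J C'. With (IK)_t = dH, the
element b with c p^k h = d^k b, for c in C and h in K^k, satisfies b p in I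
because the hypothesis holds for k + 1 as well. Multiplying (bp)^k in I^k by h
gives b^(k+1) in cH, hence b is in the radical ideal J. This shows that C p^k
is contained in (J I^k)_t, and J cancels. *)
Lemma cic_radical I Js p : tinv_radical I -> {in Js, forall J, tinv_radical J} ->
  (forall k, mulset (setprod Js) [set p ^+ k] `<=` t_op (setpow I k)) -> I p.
Proof.
move=> [tI rI [K [d [nd eK]]]] tJs.
have [zp|np] := pselect (zset H p); first by move=> _; exact: (zset_t_ideal ng).
elim: Js tJs => [_ /(_ 1%N)|J Js IH tJs hyp].
  rewrite big_nil mul1set /= mulsetC mul1set tI expg1; exact.
have [tJ rJ iJ] := tJs _ (mem_head _ _).
apply: IH => [J' J'Js|k]; first by apply: tJs; rewrite in_cons J'Js orbT.
apply: (tinv_cancel ng iJ); set C := setprod (J :: Js).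
have CJ : C `<=` J.
  by apply: (prod_sub ng) => [J' /tJs[]|] //; exact: mem_head.
have pow_dvd l x k' : t_op (setpow I l) x -> setpow K l k' ->
    dvd (d ^+ l) (x * k').
  move=> Ix Kk; apply/mem_pideal; rewrite -(t_op_setpow_inverse l eK).
  by rewrite -(t_opMl ng); apply: (sub_t_op ng); exact: mem_mulset.
have nd' l : ~ zset H (d ^+ l) := nonzeroX nd.
have np' l : ~ zset H (p ^+ l) := nonzeroX np.
(* C p^k K^k = d^k B for a subset B of H; the point is that B lies in J. *)
have key : mulset (mulset C [set p ^+ k]) (setpow K k) `<=`
           mulset [set d ^+ k] J.
  move=> _ [_ [c Cc [_ -> <-]] [h Kh <-]].
  have Cp l : t_op (setpow I l) (c * p ^+ l) by apply: hyp; exact: mem_mulset.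
  have [b eb] := pow_dvd k _ _ (Cp k) Kh.
  rewrite eb; apply: mem_mulset => //.
  have Ibp : I (b * p).
    apply: (mem_by_inverse tI nd eK) => h' Kh'.
    have [g eg] := pow_dvd k.+1 _ (h' * h) (Cp k.+1) (mem_mulset Kh' Kh).
    exists g; apply: (nonzero_mulgI _ (nd' k)) => /=.
    rewrite (_ : d ^+ k * (d * g) = d * d ^+ k * g); last by mulg_ac.
    rewrite -expgS -eg expgS.
    rewrite (_ : d ^+ k * _ = d ^+ k * b * (p * h')); last by mulg_ac.
    by rewrite -eb; mulg_ac.
  have [g eg] := pow_dvd k _ _ (sub_t_op ng (mem_setpow k Ibp)) Kh.
  rewrite -rJ; exists k.+1 => //; rewrite expgS.
  rewrite (_ : b * b ^+ k = c * g).
    by apply: (t_idealM ng) => //; exact: CJ.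
  apply: (nonzero_mulgI _ (nonzeroM (nd' k) (np' k))) => /=.
  rewrite (_ : _ * (b * b ^+ k) = d ^+ k * b * (b ^+ k * p ^+ k)); last by mulg_ac.
  rewrite -eb (_ : _ * (c * g) = c * p ^+ k * (d ^+ k * g)); last by mulg_ac.
  by rewrite -eg expMn; mulg_ac.
have eC : C = mulset J (setprod Js) by rewrite /C big_cons.
rewrite mulsetA -eC; apply: (sub_scale (nd' k)).
rewrite -(t_op_scale ng) //.
apply: (@subset_trans _ (t_op (mulset (mulset C [set p ^+ k]) (pideal (d ^+ k))))).
  apply: subset_trans (sub_t_op ng).
  by rewrite mulsetC; apply: mulset_sub => // _ ->; exact: pideal_refl.
rewrite -(t_op_setpow_inverse k eK) (t_opMr ng); apply: (t_opS ng).
rewrite (_ : mulset _ (mulset _ (setpow K k)) =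
  mulset (mulset (mulset C [set p ^+ k]) (setpow K k)) (setpow I k)); last first.
  by mulset_ac.
by rewrite mulsetA; exact: mulset_sub.
Qed.

(** Once p is in the first factor I, each element of p I^(-1) satisfies the
hypothesis for the product Q of the other factors, so p I^(-1) is contained in
Q_t; multiply by I. *)
Lemma cic_setprod Is Js p : {in Is, forall I, tinv_radical I} ->
  {in Js, forall J, tinv_radical J} ->
  (forall k, mulset (setprod Js) [set p ^+ k] `<=`
             t_op (setpow (setprod Is) k)) ->
  t_op (setprod Is) p.
Proof.
move=> tIs tJs; elim: Is tIs p => [|I Is IH] tIs p.
  by move=> _; rewrite big_nil (t_op1 ng) mul1set.
rewrite big_cons; set Q := setprod Is => hyp.
have tI := tIs _ (mem_head _ _).
have Ip : I p.
  apply: (cic_radical tI tJs) => k; apply: subset_trans (hyp k) _.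
  rewrite setpowM; apply: (t_op_min ng) => _ [x Ix [y _ <-]].
  apply: (t_idealM ng); [exact: (t_op_idem ng)|exact: (sub_t_op ng)].
case: tI => tI _ [K [d [nd eK]]].
have sub : mulset [set p] K `<=` mulset [set d] (t_op Q).
  move=> _ [_ -> [h Kh <-]].
  have [w ew] : dvd d (p * h).
    apply/mem_pideal; rewrite -eK; apply: (sub_t_op ng); exact: mem_mulset.
  rewrite ew; apply: mem_mulset => //; apply: IH => [J JIs|k].
    by apply: tIs; rewrite in_cons JIs orbT.
  move=> _ [c Cc [_ -> <-]].
  have nd' : ~ zset H (d ^+ k) := nonzeroX nd.
  apply: (mem_scale nd'); rewrite -(t_op_pidealM ng) //.
  rewrite -(t_op_setpow_inverse k eK) (t_opMl ng) -mulsetA.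
  rewrite (mulsetC (setpow K k)) mulsetA -setpowM -(t_opMl ng).
  rewrite (_ : d ^+ k * _ = c * p ^+ k * h ^+ k).
    apply: (sub_t_op ng); apply: mem_mulset; last exact: mem_setpow.
    by apply: hyp; exact: mem_mulset.
  rewrite (_ : _ * (c * w ^+ k) = c * (d ^+ k * w ^+ k)); last by mulg_ac.
  by rewrite -expMn -ew expMn; mulg_ac.
apply: (mem_scale nd); rewrite -(t_op_scale ng) //.
have sub' : mulset (mulset [set p] K) I `<=`
            mulset [set d] (t_op (mulset I Q)).
  apply: (@subset_trans _ (mulset (mulset [set d] (t_op Q)) I)).
    exact: mulset_sub.
  rewrite -mulsetA (mulsetC I); apply: mulset_sub => //.
  exact: (t_op_mulset ng).
rewrite (t_op_scale ng) // -(t_op_idem ng) -(t_op_scale ng) //.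
apply: (t_opS ng sub').
rewrite -mulsetA (mulsetC K) -(t_opMr ng) eK mulgC; apply: (sub_t_op ng).
by apply: mem_mulset => //; exact: pideal_refl.
Qed.

Lemma completely_integrally_closed p q c :
  (forall I, principal I -> exists Is, radical_factorization I Is) ->
  ~ zset H q -> ~ zset H c -> (forall k, dvd (q ^+ k) (c * p ^+ k)) -> dvd q p.
Proof.
move=> fac nq nc dqc.
have [Is [rIs eIs]] := fac _ (principal_pideal ng q).
have [Js [rJs eJs]] := fac _ (principal_pideal ng c).
have tIs : {in Is, forall I, tinv_radical I}.
  move=> I IIs; have [tI rI] := rIs _ IIs; split=> //.
  exact: (factor_tinv nq (conj rIs eIs) IIs).
have tJs : {in Js, forall I, tinv_radical I}.
  move=> J JJs; have [tJ rJ] := rJs _ JJs; split=> //.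
  exact: (factor_tinv nc (conj rJs eJs) JJs).
apply/mem_pideal; rewrite eIs; apply: (cic_setprod tIs tJs) => k.
rewrite -t_op_setpow -/(t_prod Is) -eIs -(t_op1 ng) t_op_setpow setpow1.
move=> _ [x Cx [_ -> <-]]; rewrite (t_op1 ng); apply/mem_pideal.
have [h ->] : dvd c x.
  by apply/mem_pideal; rewrite eJs; exact: (sub_t_op ng).
have [g eg] := dqc k; exists (g * h).
rewrite (_ : c * h * _ = c * p ^+ k * h); last by mulg_ac.
by rewrite eg; mulg_ac.
Qed.

(** Let E be a finite set that t-generates A = xH cap yH, and F the set of all
e / x and e / y with e in E. If q divides p F, then p A is contained in q A, so
q divides p by complete integral closure. Hence F t-generates H and some f of F
is outside M; as x f or y f is in E, which is contained in A, either y divides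
x f or x divides y f. *)
Lemma conductor_valuative : t_finite_conductor H ->
  (forall I, principal I -> exists Is, radical_factorization I Is) ->
  t_valuative H.
Proof.
move=> fc fac M mM x y nx ny.
have [tA [E [EA fE eA]]] := fc x y; set A := _ `&` _ in tA EA eA.
have img z : E `<=` pideal z -> exists E',
    finite_set E' /\ E = (fun h => z * h) @` E'.
  move=> Ez; have [|E' [_ fE' eE]] := @finite_sub_image _ _ (fun h => z * h) setT _ fE.
    by move=> e /Ez /mem_pideal[h ->]; exists h.
  by exists E'.
have [E1 [fE1 eE1]] := img x (fun e Ee => (EA e Ee).1).
have [E2 [fE2 eE2]] := img y (fun e Ee => (EA e Ee).2).
have F1 : t_op (E1 `|` E2) 1.
  apply/(t_opP ng); exists (E1 `|` E2); split=> //; first by rewrite finite_setU.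
  apply/v_opP => p q nq dF; rewrite mulg1.
  have pE : mulset [set p] E `<=` mulset [set q] A.
    move=> _ [_ -> [e Ee <-]].
    have [f1 E1f ef1] : ((fun h => x * h) @` E1) e by rewrite -eE1.
    have [f2 E2f ef2] : ((fun h => y * h) @` E2) e by rewrite -eE2.
    have [h1 eh1] := dF f1 (or_introl E1f).
    have [h2 eh2] := dF f2 (or_intror E2f).
    have e1 : p * e = q * (x * h1).
      rewrite -ef1 (_ : p * (x * f1) = x * (p * f1)); last by mulg_ac.
      by rewrite eh1; mulg_ac.
    have e2 : p * e = q * (y * h2).
      rewrite -ef2 (_ : p * (y * f2) = y * (p * f2)); last by mulg_ac.
      by rewrite eh2; mulg_ac.
    rewrite e1; apply: mem_mulset => //; split; apply/mem_pideal.
      by exists h1.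
    by exists h2; apply: (nonzero_mulgI _ nq) => /=; rewrite -e1.
  have pA : mulset [set p] A `<=` mulset [set q] A.
    rewrite -{2}tA -(t_op_scale ng) // eA (mulsetC [set p]).
    apply: subset_trans (t_op_mulset ng (Y:=_)) _.
    by rewrite -eA mulsetC; exact: (t_opS ng).
  apply: (completely_integrally_closed fac nq (nonzeroM nx ny)) => k.
  have [a _ ->] : exists2 a, A a & x * y * p ^+ k = q ^+ k * a; last by exists a.
  elim: k => [|k [a Aa IH]].
    exists (x * y); last by rewrite !expg0 mulg1 mul1g.
    by split; apply/mem_pideal; [exists y|exists x; rewrite mulgC].
  have [_ -> [a' Aa' ea']] := pA (p * a) (mem_mulset erefl Aa).
  exists a' => //; rewrite !expgSr mulgA IH.
  rewrite (_ : q ^+ k * a * p = q ^+ k * (p * a)); last by mulg_ac.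
  by rewrite -ea' mulgA.
have [f Ff nMf] : exists2 f, (E1 `|` E2) f & ~ M f.
  apply: contrapT => no; apply: (t_max1 ng mM).
  apply: (t_op_sub ng _ _ F1); first exact: t_max_t.
  by move=> h Fh; apply: contrapT => nMh; apply: no; exists h.
exists f => //; case: Ff => [E1f|E2f]; [right|left]; rewrite mulgC; apply/mem_pideal.
  by apply: (EA _ _).2; rewrite eE1; exists f.
by apply: (EA _ _).1; rewrite eE2; exists f.
Qed.

End CompleteIntegralClosure.

(** * Discrete valuation monoids *)

Section DiscreteValuation.
Local Open Scope group_scope.
Local Open Scope classical_set_scope.

(** The s-ideal generated by x and y is principal, and its generator is a
multiple of x or of y. *)
Lemma DVM_dvd_total (N : cancelMonoidType) (x y : N) : DVM N ->
  ~ zset N x -> ~ zset N y -> dvd x y \/ dvd y x.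
Proof.
move=> [_ prN] nx ny; pose X := mulset [set x; y] setT `|` zset N.
have sX : s_ideal X.
  apply/seteqP; split=> [z Xz|z [[w Xw [h _ <-]]|zz]]; last by right.
    by left; rewrite -(mulg1 z); exact: mem_mulset.
  case: Xw => [[v xy [k _ <-]]|zw]; last by right; rewrite mulgC; exact: zsetM.
  by left; rewrite -mulgA; exact: mem_mulset.
have [A [A1 eX]] := prN X sX.
have gen z : [set x; y] z -> ~ zset N z -> exists2 a, A a & dvd a z.
  move=> xyz nz; have : X z by left; rewrite -(mulg1 z); exact: mem_mulset.
  by rewrite eX => -[[a Aa [h _ <-]]|//]; exists a => //; exists h.
have [a Aa ax] := gen x (or_introl erefl) nx.
have [b Ab by_] := gen y (or_intror erefl) ny.
rewrite (A1 _ _ Ab Aa) {b Ab} in by_.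
have : X a by rewrite eX; left; rewrite -(mulg1 a); exact: mem_mulset.
case=> [[_ [->|->] [h _ ea]]|za].
- by left; apply: dvd_trans by_; exists h.
- by right; apply: dvd_trans ax; exists h.
- by case: ax nx => h -> []; rewrite mulgC; exact: zsetM.
Qed.

Variable H : cancelMonoidType.
Implicit Types (x y h s u : H) (M : set H).

Lemma zset_loc (S : denom H) h (s : set_type S) : zset (loc S) (mkfrac h s) <-> zset H h.
Proof.
split=> [zl x|]; last exact: zset_mkfrac.
have := zl (toloc S x); rewrite /toloc mkfracM => /eq_mkfrac /= e.
have ns : ~ zset H (val s) := @frac_nz H S (h, s).
apply: (nonzero_mulgI _ ns) => /=.
rewrite (_ : val s * (h * x) = h * x * val s); last by mulg_ac.
by rewrite e mulg1 mulgC.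
Qed.

Lemma t_almost_Dedekind_valuative : ~ is_quot H -> t_almost_Dedekind H ->
  t_valuative H.
Proof.
move=> ng [//|dvm] M mM x y nx ny; pose S := prime_denom (t_max_prime mM).
have half z t : dvd (toloc S z) (toloc S t) -> exists2 s, ~ M s & dvd z (s * t).
  move=> [w]; rewrite (mkfrac_repr w) /toloc mkfracM => /eq_mkfrac /=.
  rewrite mul1g mulg1 => e; exists (val (repr w).2).
    exact: (set_valP (repr w).2).
  by exists (repr w).1; rewrite mulgC.
have nz z : ~ zset H z -> ~ zset (loc S) (toloc S z) by move=> n /zset_loc.
have [/half|/half] := DVM_dvd_total (dvm M mM) (nz x nx) (nz y ny).
  by move=> [s nMs d]; exists s => //; left.
by move=> [s nMs d]; exists s => //; right.
Qed.

Lemma t_max_has_nonzero M : ~ is_quot H -> t_max M ->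
  exists2 x, M x & ~ zset H x.
Proof.
move=> ng [tM nM maxM]; have [b nb nunit] := nonunit ng.
apply: contrapT => no.
have Mz : M `<=` zset H.
  by move=> x Mx; apply: contrapT => nx; apply: no; exists x.
apply/nb/Mz; rewrite -(maxM (pideal b)); first exact: pideal_refl.
- exact: t_ideal_pideal.
- by move=> e; apply/nunit/mem_pideal; rewrite e.
- by move=> z /Mz; apply: (zset_t_ideal ng); exact: t_ideal_pideal.
Qed.

(** Every nonzero element of the localization is associated with a power of the
uniformizer a, so a nonzero s-ideal is generated by the least power of a that
it contains. *)
Lemma rad_tinv_DVM M (mM : t_max M) : ~ is_quot H -> rad_tinv H ->
  DVM (loc_at (t_max_prime mM)).
Proof.
move=> ng radH; set S := prime_denom (t_max_prime mM).
have [x0 Mx0 nx0] := t_max_has_nonzero ng mM.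
have [a [Ma na ordM]] := local_uniformizer ng radH mM Mx0 nx0.
pose den u (nMu : ~ M u) : set_type S := SigSub (mem_set (nMu : denom_set S u)).
have tolocM x y : toloc S (x * y) = toloc S x * toloc S y.
  exact: (toloc_monoid_morphism S).2.
split.
  move=> /is_quotP/(_ (toloc S a))[|w]; first by move/zset_loc.
  rewrite (mkfrac_repr w) /toloc mkfracM => /eq_mkfrac /=.
  rewrite mulg1 !mul1g => e; apply: (set_valP (repr w).2).
  rewrite -[X in M X]e; apply: (t_idealM ng) => //; exact: t_max_t.
have assoc (w : loc S) : ~ zset (loc S) w -> exists k,
    dvd (toloc S (a ^+ k)) w /\ dvd w (toloc S (a ^+ k)).
  rewrite (mkfrac_repr w); case: (repr w) => h s nw.
  have [|k [t [u [nMt nMu e]]]] := ordM h; first by move/zset_loc: nw.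
  exists k; split.
    exists (mkfrac u (denmul s (den t nMt))).
    rewrite /toloc mkfracM; apply/eq_mkfrac => /=.
    rewrite (_ : h * _ = t * h * val s); last by mulg_ac.
    by rewrite e.
  exists (mkfrac (val s * t) (den u nMu)).
  rewrite /toloc mkfracM; apply/eq_mkfrac => /=.
  rewrite (_ : h * _ * _ = t * h * val s); last by mulg_ac.
  by rewrite e; mulg_ac.
move=> X sX.
have XM w v : X w -> X (w * v).
  by move=> Xw; rewrite sX; left; apply: mem_mulset.
have Xz : zset (loc S) `<=` X by move=> w zw; rewrite sX; right.
have [[w Xw nw]|no] := pselect (exists2 w, X w & ~ zset (loc S) w); last first.
  exists set0; split; first by move=> ? ?.
  apply/seteqP; split=> w; last by case=> [[]|/Xz].
  by move=> Xw; right; apply: contrapT => nw; apply: no; exists w.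
have exk : exists k, `[< X (toloc S (a ^+ k)) >].
  have [k [_ [v ev]]] := assoc w nw.
  by exists k; apply/asboolP; rewrite ev; exact: XM.
case: (ex_minnP exk) => k /asboolP Xk mink.
exists [set toloc S (a ^+ k)]; split; first by move=> ? ? -> ->.
apply/seteqP; split=> [v Xv|v [[_ -> [u _ <-]]|/Xz//]]; last exact: XM.
have [zv|nv] := pselect (zset (loc S) v); first by right.
left; apply/mem_pideal; have [l [[v1 ev1] [v2 ev2]]] := assoc v nv.
have kl : (k <= l)%N by apply: mink; apply/asboolP; rewrite ev2; exact: XM.
exists (toloc S (a ^+ (l - k)) * v1).
by rewrite ev1 mulgA -tolocM -expgnDr subnKC.
Qed.

Lemma rad_tinv_almost_Dedekind : ~ is_quot H -> rad_tinv H ->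
  t_almost_Dedekind H.
Proof. by move=> ng radH; right=> M mM; exact: rad_tinv_DVM. Qed.

End DiscreteValuation.

(** * Monoids that coincide with their quotient monoid *)

Section Quotient.
Local Open Scope group_scope.
Local Open Scope classical_set_scope.
Variable H : cancelMonoidType.
Hypothesis gH : is_quot H.
Implicit Types (x y : H) (X I : set H).

Lemma quot_t_op_nonzero X x : X x -> ~ zset H x -> t_op X = setT.
Proof.
move=> Xx nx; rewrite /t_op; case: pselect => // g'.
by case: pselect => // Xz; case: nx; exact: Xz.
Qed.

Lemma quot_t_op_zset X : X `<=` zset H -> t_op X = zset H.
Proof. by move=> Xz; rewrite /t_op; case: pselect => // g'; case: pselect. Qed.

Lemma quot_pideal x : ~ zset H x -> pideal x = setT.
Proof.
move=> nx; apply/seteqP; split=> // y _.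
have [z xz] := (is_quotP H).1 gH x nx.
by apply/mem_pideal; exists (z * y); rewrite mulgA xz mul1g.
Qed.

Lemma quot_t_idealP I : t_ideal I <-> I = zset H \/ I = setT.
Proof.
split=> [<-|[->|->]]; last 2 first.
- exact: quot_t_op_zset.
- exact: quot_t_op_nonzero (@nonzero1 H).
have [Iz|] := pselect (I `<=` zset H).
  by left; exact: quot_t_op_zset.
by move=> /existsNP[x /not_implyP[Ix nx]]; right; exact: quot_t_op_nonzero nx.
Qed.

Lemma quot_principal I : principal I -> I = zset H \/ I = setT.
Proof.
move=> [A [A1 ->]].
have [[a Aa na]|no] := pselect (exists2 a, A a & ~ zset H a).
  right; apply/seteqP; split=> // y _; left.
  have : pideal a y by rewrite quot_pideal.
  by move=> [_ -> [h _ <-]]; exact: mem_mulset.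
left; apply/seteqP; split=> [y [[a Aa [h _ <-]]|//]|y]; last by right.
by rewrite mulgC; apply: zsetM; apply: contrapT => na; apply: no; exists a.
Qed.

Lemma quot_comparable_factorization I : t_ideal I ->
  exists Is, radical_factorization I Is /\ pairwise_comparable Is.
Proof.
case/quot_t_idealP=> ->.
  exists [:: zset H]; split; last first.
    by move=> J K; rewrite !mem_seq1 => /eqP-> /eqP->; left.
  split; last first.
    by rewrite /t_prod big_cons big_nil mulsetC mul1set quot_t_op_zset.
  move=> J; rewrite mem_seq1 => /eqP->; split; last exact: zset_radical.
  exact: quot_t_op_zset.
exists [::]; split=> //; split=> //; rewrite /t_prod big_nil.
by rewrite (quot_t_op_nonzero _ (@nonzero1 H)).
Qed.

Lemma quot_finite_conductor : t_finite_conductor H.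
Proof.
move=> x y; set I := _ `&` _.
have [[w [xw yw] nw]|no] := pselect (exists2 w, I w & ~ zset H w).
  have -> : I = setT.
    have [h eh] := (mem_pideal _ _).1 xw; have [k ek] := (mem_pideal _ _).1 yw.
    have [nx _] : ~ zset H x /\ ~ zset H h.
      by apply: nonzero_factors; rewrite -eh.
    have [ny _] : ~ zset H y /\ ~ zset H k.
      by apply: nonzero_factors; rewrite -ek.
    by rewrite /I (quot_pideal nx) (quot_pideal ny) setTI.
  split; first by apply/quot_t_idealP; right.
  exists [set 1]; split=> //.
  by rewrite (quot_t_op_nonzero _ (@nonzero1 H)).
have -> : I = zset H.
  apply/seteqP; split=> w; last first.
    by move=> zw; split; apply/mem_pideal; exact: dvd_zset.
  by move=> Iw; apply: contrapT => nw; apply: no; exists w.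
split; first by apply/quot_t_idealP; left.
by exists set0; split=> //; rewrite quot_t_op_zset.
Qed.

Lemma quot_rad_t_invertible : rad_t_invertible H.
Proof.
move=> I /quot_principal[->|->] [//_ nI].
have -> : rad [set: H] = setT by apply/seteqP; split=> // x _; exact: sub_rad.
split; first by apply/quot_t_idealP; right.
apply: (@quot_t_op_nonzero _ 1); last exact: nonzero1.
exists 1, 1; split=> //.
  by move=> _ [x _ <-]; exists x => //; rewrite mul1g.
by rewrite mulg1.
Qed.

End Quotient.

(** * The equivalence *)

Theorem theorem4p2 (H : cancelMonoidType) :
  [<-> t_almost_Dedekind H /\ t_SP_monoid H;
       t_finite_conductor H /\
         (forall I : set H, principal I -> exists Is, radical_factorization I Is);
       forall I : set H, t_ideal I ->
         exists Is, radical_factorization I Is /\ pairwise_comparable Is;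
       forall I : set H, principal I -> nontrivial I -> t_invertible (rad I)].
Proof.
have [gH|ng] := pselect (is_quot H).
  have fac := quot_comparable_factorization gH.
  have fac' (I : set H) : t_ideal I -> exists Is, radical_factorization I Is.
    by move=> /fac[Is []]; exists Is.
  tfae=> _.
  - split; first exact: quot_finite_conductor.
    by move=> I /(quot_principal gH)/(quot_t_idealP gH)/fac'.
  - exact: fac.
  - exact: quot_rad_t_invertible.
  - by split; [left|exact: fac'].
have fac4 : rad_t_invertible H -> forall I : set H, t_ideal I ->
    exists Is, radical_factorization I Is /\ pairwise_comparable Is.
  by move/(rad_t_invertibleP ng) => radH; exact: comparable_factorization.
have fac4' : rad_t_invertible H -> t_SP_monoid H.
  by move=> r4 I /(fac4 r4)[Is []]; exists Is.
have of_valuative : t_valuative H ->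
    (forall I : set H, principal I -> exists Is, radical_factorization I Is) ->
    rad_t_invertible H.
  by move=> V fac; apply/(rad_t_invertibleP ng); exact: valuative_rad_tinv.
have from1 : t_almost_Dedekind H /\ t_SP_monoid H -> rad_t_invertible H.
  move=> [/(t_almost_Dedekind_valuative ng) V sp].
  by apply: of_valuative => // I /(principal_t_ideal ng)/sp.
have from2 : t_finite_conductor H /\
    (forall I : set H, principal I -> exists Is, radical_factorization I Is) ->
    rad_t_invertible H.
  move=> [fc fac]; apply: of_valuative => //.
  exact: conductor_valuative.
have from3 : (forall I : set H, t_ideal I ->
      exists Is, radical_factorization I Is /\ pairwise_comparable Is) ->
    rad_t_invertible H.
  by move=> fac; apply/(rad_t_invertibleP ng); exact: comparable_rad_tinv.
tfae.
- move=> /from1 r4; split.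
    by apply: finite_conductor => //; apply/rad_t_invertibleP.
  by move=> I /(principal_t_ideal ng)/(fac4' r4).
- by move=> /from2/fac4.
- exact: from3.
- move=> r4; split; last exact: fac4'.
  by apply: rad_tinv_almost_Dedekind => //; apply/rad_t_invertibleP.
Qed.
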